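(* Let $B$ be a $3$-manifold, and let $u=[u_i\,dx^i]:B\to H^1(T^3,\mathbb{R})$ and $v=[\tfrac12\epsilon_{ijk}v^i\,dx^{jk}]:B\to H^2(T^3,\mathbb{R})$ be local diffeomorphisms such that $(u,v)$ immerses $B$ as a Lagrangian submanifold of $H^1(T^3,\mathbb{R})\oplus H^2(T^3,\mathbb{R})$, so that locally there is a function $\phi$ on $B$ with $v^i=\partial\phi/\partial u_i$. Let $$\tilde u = u\cup[dt]+v : B\to H^2(T^4,\mathbb{R}),\qquad T^4=T^3\times T^1,$$ and suppose that the metric induced on $B$ by $\tilde u$ from the intersection form, which up to a constant multiple is $g=\frac{\partial^2\phi}{\partial u_i\partial u_j}du_i\,du_j$, is positive definite. Then $\tilde u$ is a minimal immersion (equivalently, all components of $\tilde u$ are harmonic for $g$, which is the condition for $\tilde u$ to define a semi-flat $G_2$-manifold) if and only if $\phi$ satisfies the Monge-Amp\`ere equation $$d\,\det\!\left(\frac{\partial^2\phi}{\partial u_i\partial u_j}\right)=0.$$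
   Context: $T^3=\mathbb{R}^3/\mathbb{Z}^3$ has coordinates $x^1,x^2,x^3$ and $T^1=\mathbb{R}/\mathbb{Z}$ has coordinate $t$; $T^4$ is oriented by $dx^1\wedge dx^2\wedge dx^3\wedge dt$. $\cup$ denotes the cup product. $H^2(T^4,\mathbb{R})$ carries the signature $(3,3)$ intersection form $(\alpha,\beta)\mapsto\int_{T^4}\alpha\wedge\beta$. The symplectic form on $H^1(T^3,\mathbb{R})\oplus H^2(T^3,\mathbb{R})$ is $\omega((\zeta^1,\zeta^2),(\eta^1,\eta^2))=\frac12(\zeta^1(\eta^2)-\eta^1(\zeta^2))$, using the duality $\zeta^1(\eta^2)=\int_{T^3}\zeta^1\wedge\eta^2$ between $H^1$ and $H^2$. $\epsilon_{ijk}$ is totally antisymmetric with $\epsilon_{123}=1$, and repeated indices are summed. The $u_i$ are used as local coordinates on $B$. An immersion is minimal if it is harmonic with respect to the induced metric. *)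

(* Defs.v *)
From HB Require Import structures.
From mathcomp Require Import all_boot all_order all_algebra.
From mathcomp Require Import all_classical all_reals all_analysis.
Set Implicit Arguments.
Unset Strict Implicit.
Unset Printing Implicit Defensive.
Import Order.TTheory GRing.Theory Num.Theory numFieldNormedType.Exports.
Local Open Scope classical_set_scope.
Local Open Scope ring_scope.

Section Calculus.
Variables (R : realType) (n : nat).
Implicit Types (f : 'rV[R]_n -> R) (g : 'rV[R]_n -> 'M[R]_n).

Definition partial (i : 'I_n) f : 'rV[R]_n -> R :=
  fun x => 'D_(delta_mx 0 i) f x.

(* C^infinity on A, which is meant to be open: the iterated partial
   derivatives of all orders (order 0 included) are Frechet differentiable. *)
Definition smooth_on (A : set 'rV[R]_n) f :=
  forall (s : seq 'I_n) x, A x -> differentiable (foldr partial f s) x.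

Definition hessian f : 'rV[R]_n -> 'M[R]_n :=
  fun x => \matrix_(i, j) partial i (partial j f) x.

Definition posdef (M : 'M[R]_n) :=
  forall w : 'rV[R]_n, w != 0 -> 0 < (w *m M *m w^T) 0 0.

(* Laplace-Beltrami operator of the Riemannian metric g_ij dx^i dx^j:
   (det g)^(-1/2) d_i ((det g)^(1/2) g^ij d_j f). *)
Definition laplacian g f : 'rV[R]_n -> R := fun x =>
  (Num.sqrt (\det (g x)))^-1 *
  \sum_i partial i (fun y => Num.sqrt (\det (g y)) *
                             \sum_j invmx (g y) i j * partial j f y) x.

End Calculus.

(* [chart_inv] is only relevant on the image of [dom]. *)
Record chart (R : realType) (n : nat) (T : topologicalType) := Chart {
  chart_map :> T -> 'rV[R]_n;
  chart_inv : 'rV[R]_n -> T;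
  dom : set T;
  chart_dom_open : open dom;
  chart_img_open : open (chart_map @` dom);
  chart_mapK : forall p, dom p -> chart_inv (chart_map p) = p;
  chart_map_continuous : forall p, dom p -> {for p, continuous chart_map};
  chart_inv_continuous :
    forall x, (chart_map @` dom) x -> {for x, continuous chart_inv} }.

Definition smooth_transition (R : realType) (n : nat) (T : topologicalType)
    (c d : chart R n T) :=
  forall i, smooth_on (c @` (dom c `&` dom d))
                      (fun x => d (chart_inv c x) 0 i).

Record manifold (R : realType) (n : nat) := Manifold {
  carrier :> topologicalType;
  atlas : set (chart R n carrier);
  manifold_hausdorff : hausdorff_space carrier;
  manifold_second_countable : @second_countable carrier;
  atlas_cover : forall p : carrier, exists2 c, atlas c & dom c p;
  atlas_smooth : forall c d, atlas c -> atlas d -> smooth_transition c d }.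

Section Manifold.
Variables (R : realType) (n : nat) (M : manifold R n).
Implicit Types (c : chart R n M) (f : M -> R) (u : M -> 'rV[R]_n).

(* Membership in the maximal atlas, i.e. c is a diffeomorphism from dom c onto
   an open subset of R^n. *)
Definition smooth_chart c :=
  forall d, atlas d -> smooth_transition c d /\ smooth_transition d c.

Definition smooth (U : set M) f :=
  forall c, smooth_chart c -> smooth_on (c @` (dom c `&` U)) (f \o chart_inv c).

(* c is the local coordinate system given by the components of u. *)
Definition coordinates u c :=
  smooth_chart c /\ forall p, dom c p -> c p = u p.

Definition local_diffeo u :=
  forall p, exists2 c, coordinates u c & dom c p.

(* A 2-tensor field on M, given by its matrix of components in each chart. *)
Definition tensor2 := chart R n M -> 'rV[R]_n -> 'M[R]_n.

Definition positive_definite (g : tensor2) :=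
  forall c p, smooth_chart c -> dom c p -> posdef (g c (c p)).

Definition harmonic (g : tensor2) f :=
  forall c p, smooth_chart c -> dom c p ->
    laplacian (g c) (f \o chart_inv c) (c p) = 0.

Variable V : vectType R.
Implicit Types (F : M -> V) (Q : V -> V -> R).

Definition smooth_map F := forall l : 'Hom(V, R^o), smooth setT (l \o F).

(* The partial derivatives of F in the chart c; the derivative of a V-valued
   function is taken componentwise in a basis of V. *)
Definition map_partial F c (a : 'I_n) (x : 'rV[R]_n) : V :=
  \sum_i partial a (fun y => coord (vbasis fullv) i (F (chart_inv c y))) x
         *: (vbasis fullv)`_i.

Definition immersion F :=
  smooth_map F /\
  forall c p, smooth_chart c -> dom c p -> forall w : 'I_n -> R,
    \sum_a w a *: map_partial F c a (c p) = 0 -> forall a, w a = 0.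

(* The pull-back by F of a bilinear form Q on V. *)
Definition pullback_form Q F : tensor2 := fun c x =>
  \matrix_(a, b) Q (map_partial F c a x) (map_partial F c b x).

Definition lagrangian_immersion (omega : V -> V -> R) F :=
  [/\ immersion F, \dim (fullv : {vspace V}) = n.*2 &
   forall c p, smooth_chart c -> dom c p -> pullback_form omega F c (c p) = 0].

(* As V is flat, F is a harmonic map if and only if all its components are
   harmonic functions. *)
Definition harmonic_map (g : tensor2) F :=
  forall l : 'Hom(V, R^o), harmonic g (l \o F).

Definition minimal_immersion Q F :=
  immersion F /\ harmonic_map (pullback_form Q F) F.

End Manifold.

Notation ksubset n k := {I : {set 'I_n} | #|I| == k}.

Section Torus.
Variable R : realType.

(* H^k(T^n, R), identified with the space of constant coefficient k-forms on
   T^n: a I is the coefficient of dx^(i_1) ... dx^(i_k), where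
   I = {i_1 < ... < i_k}. *)
Definition cohom (n k : nat) := {ffun ksubset n k -> R^o}.

Definition dx n (i : 'I_n) : cohom n 1 :=
  [ffun I : ksubset n 1 => (val I == [set i]%SET)%:R].

(* The number of transpositions sorting dx^I dx^J. *)
Definition inversions n (I J : {set 'I_n}) : nat :=
  #|[set p : 'I_n * 'I_n | [&& p.1 \in I, p.2 \in J & (p.2 < p.1)%N]]%SET|.

(* The cardinals force I and J to be disjoint when I :|: J = K. *)
Definition cup n k l (a : cohom n k) (b : cohom n l) : cohom n (k + l) :=
  [ffun K : ksubset n (k + l) => \sum_(I : ksubset n k)
     \sum_(J : ksubset n l | (val I :|: val J)%SET == val K)
       (-1) ^+ inversions (val I) (val J) * (a I * b J)].

(* Integration over T^n oriented by dx^1 ... dx^n: the only summand is the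
   coefficient of dx^1 ... dx^n. *)
Definition torus_integral n (a : cohom n n) : R := \sum_I a I.

(* The pull-backs by the projections of T^(m + p) = T^m x T^p; the coordinates
   of T^p come after those of T^m. *)
Definition proj1_pullback m p k (a : cohom m k) : cohom (m + p) k :=
  [ffun K : ksubset (m + p) k =>
     \sum_(I : ksubset m k | (@lshift m p @: val I)%SET == val K) a I].

Definition proj2_pullback m p k (a : cohom p k) : cohom (m + p) k :=
  [ffun K : ksubset (m + p) k =>
     \sum_(I : ksubset p k | (@rshift m p @: val I)%SET == val K) a I].

Definition intersection_form (a b : cohom 4 2) : R := @torus_integral 4 (cup a b).

Definition symplectic_form (z e : cohom 3 1 * cohom 3 2) : R :=
  2^-1 * (@torus_integral 3 (cup z.1 e.2) - @torus_integral 3 (cup e.1 z.2)).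

Definition epsilon (i j k : 'I_3) : R :=
  (uniq [:: i; j; k])%:R * (-1) ^+ ((j < i) + (k < i) + (k < j))%N.

Definition H1_class (u : 'rV[R]_3) : cohom 3 1 := \sum_i u 0 i *: dx i.

Definition H2_class (v : 'rV[R]_3) : cohom 3 2 :=
  \sum_i \sum_j \sum_k
    (2^-1 * epsilon i j k * v 0 i) *: (cup (dx j) (dx k) : cohom 3 2).

Definition dt : cohom 1 1 := dx ord0.

End Torus.

Section Lagrangian.
Variables (R : realType) (B : manifold R 3) (u v : B -> 'rV[R]_3).

Definition uv_map (p : B) : cohom R 3 1 * cohom R 3 2 :=
  (H1_class (u p), H2_class (v p)).

Definition utilde (p : B) : cohom R 4 2 :=
  cup (@proj1_pullback R 3 1 1 (H1_class (u p)))
      (@proj2_pullback R 3 1 1 (dt R))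
  + @proj1_pullback R 3 1 2 (H2_class (v p)).

Definition induced_metric : tensor2 B :=
  pullback_form (@intersection_form R) utilde.

(* phi is a smooth function on the open set U with v^i = d phi / d u_i; only
   the values of phi on U matter. *)
Definition potential (U : set B) (phi : B -> R) :=
  [/\ open U, smooth U phi &
   forall c p i, coordinates u c -> dom c p -> U p ->
     v p 0 i = partial i (phi \o chart_inv c) (u p)].

(* The matrix of d^2 phi / (d u_i d u_j), as a function of the u_i. *)
Definition hessian_u (phi : B -> R) (c : chart R 3 B) : 'rV[R]_3 -> 'M[R]_3 :=
  hessian (phi \o chart_inv c).

(* f is harmonic on U for the metric (d^2 phi / (d u_i d u_j)) du_i du_j. *)
Definition hessian_harmonic (U : set B) (phi f : B -> R) :=
  forall c p, coordinates u c -> dom c p -> U p ->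
    laplacian (hessian_u phi c) (f \o chart_inv c) (u p) = 0.

Definition monge_ampere (U : set B) (phi : B -> R) :=
  forall c p, coordinates u c -> dom c p -> U p ->
    forall w, 'd (fun x => \det (hessian_u phi c x)) (u p) w = 0.

End Lagrangian.

(* Main.v *)
From HB Require Import structures.
Require Import Defs.
From mathcomp Require Import all_boot all_order all_algebra.
From mathcomp Require Import all_classical all_reals all_analysis.
From mathcomp Require Import ring lra.
Set Implicit Arguments.
Unset Strict Implicit.
Unset Printing Implicit Defensive.
Import Order.TTheory GRing.Theory Num.Theory numFieldNormedType.Exports.
Local Open Scope classical_set_scope.
Local Open Scope ring_scope.

(* In a chart, let U and V be the Jacobian matrices of u and v. Since
   horizontal and vertical classes pair to the identity under the intersection
   form, the induced metric is U V^T + V U^T, which is 2 U V^T because the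
   Lagrangian condition says that U V^T is symmetric. For G = k U V^T,
   Cramer's rule gives
     sqrt(det G) G^-1 grad u_i = rho * (row i of adj V),
     rho = sqrt(det G) / (k det V),
   and likewise for v_i with U and V exchanged. The rows of adj V are divergence
   free (Piola), so the Laplacian of u_i is, up to a positive factor, the
   derivative of rho along row i of adj V; as adj V is invertible, all the u_i
   are harmonic if and only if rho is locally constant. Since det G is
   k^3 det U det V, this means that det U / det V is locally constant, a
   condition symmetric in u and v and independent of the chart. In the
   coordinates u_i, U = 1 and V is the Hessian of phi, so it is the
   Monge-Ampere equation. The potential phi itself comes from the Poincare
   lemma: phi(x) is the integral of <v(a + t (x - a)), x - a> over t in [0, 1]. *)

(** * Partial derivatives and Frechet differentials on R^n *)

Section PartialDerivatives.
Variables (R : realType) (n : nat).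
Implicit Types (f g : 'rV[R]_n -> R) (A : set 'rV[R]_n) (x : 'rV[R]_n).

(** The vanishing of d(det U / det V), cleared of denominators as [conformal], is the hub:
    minimality, harmonicity for the Hessian metric and the Monge-Ampere equation are each compared
    with it, never with one another. This settles a mismatch: minimality quantifies over all charts,
    whereas a potential exists only locally and its Hessian is read only in the coordinates u_i.
    [conformal] makes sense in both settings, and it passes from a u-chart to any other chart
    because a change of chart multiplies det U and det V by the same Jacobian determinant.
    Invariance of the Laplacian under changes of coordinates is thus never established. The free
    factor k > 0 is there because the induced metric is 2 U V^T while the Hessian metric is U V^T.
    Factoring G keeps derivatives of an inverse matrix out of the flux: only a scalar density and a
    row of an adjugate are differentiated. The Poincare integral is differentiated only once: the
    gradient of phi is known to be smooth, and this supplies the higher derivatives. *)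

Lemma near_eq_differentiable (V W : normedModType R) (f g : V -> W) (x : V) :
  {near x, f =1 g} -> differentiable f x -> differentiable g x.
Proof.
move=> fg df; have [cf ef] := (diff_locallyP x f).1 df.
have eg : g \o shift x = cst (g x) + 'd f x +o_ 0 id.
  apply/eqaddoP => e e0; rewrite -(nbhs_singleton fg).
  have fg0 : \forall h \near (0 : V), f (h + x) = g (h + x).
    by move: fg; rewrite {1}(near_shift 0) subr0.
  have /eqaddoP/(_ e e0) := ef.
  by apply: filterS2 fg0 => h /= fgh; rewrite !fctE /= fgh.
apply/diff_locallyP.
(* The expansion of [g] with linear part ['d f x] forces ['d g x] to be that linear part. *)
by rewrite (diff_unique cf eg).
Qed.

Lemma near_eq_partial f g i x : {near x, f =1 g} -> partial i f x = partial i g x.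
Proof. exact: near_eq_derive. Qed.

Lemma partialE i f x : differentiable f x -> partial i f x = 'd f x (delta_mx 0 i).
Proof. exact: deriveE. Qed.

Lemma diff_partial f x w : differentiable f x ->
  'd f x w = \sum_i w 0 i * partial i f x.
Proof.
move=> df; rewrite {1}[w]row_sum_delta linear_sum; apply: eq_bigr => i _.
by rewrite linearZ /= partialE.
Qed.

Lemma derive_partial f x w : differentiable f x ->
  'D_w f x = \sum_i w 0 i * partial i f x.
Proof. by move=> df; rewrite deriveE// diff_partial. Qed.

Lemma partialD f g i x : differentiable f x -> differentiable g x ->
  partial i (fun y => f y + g y) x = partial i f x + partial i g x.
Proof. by move=> df dg; rewrite /partial deriveD//; exact: diff_derivable. Qed.

Lemma partialN f i x : differentiable f x ->
  partial i (fun y => - f y) x = - partial i f x.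
Proof. by move=> df; rewrite /partial deriveN//; exact: diff_derivable. Qed.

Lemma partialM f g i x : differentiable f x -> differentiable g x ->
  partial i (fun y => f y * g y) x = partial i f x * g x + f x * partial i g x.
Proof.
move=> df dg; rewrite /partial deriveM; try exact: diff_derivable.
by rewrite /GRing.scale /= addrC [g x * _]mulrC.
Qed.

Lemma partial_cst (k : R) i x : partial i (fun=> k) x = 0.
Proof. exact: derive_cst. Qed.

Lemma differentiable_sumf (I : Type) (r : seq I) (P : pred I) (h : I -> 'rV[R]_n -> R) x :
  (forall i, P i -> differentiable (h i) x) ->
  differentiable (fun y => \sum_(i <- r | P i) h i y) x.
Proof.
move=> dh; elim: r => [|j r IH].
  by rewrite (_ : (fun _ => _) = cst 0) //; apply/funext => y; rewrite big_nil.
have [Pj|nPj] := boolP (P j); last first.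
  rewrite (_ : (fun _ => _) = fun y => \sum_(i <- r | P i) h i y) //.
  by apply/funext => y; rewrite big_cons (negbTE nPj).
rewrite (_ : (fun _ => _) = h j + fun y => \sum_(i <- r | P i) h i y).
  by apply: differentiableD => //; exact: dh.
by apply/funext => y; rewrite big_cons Pj.
Qed.

Lemma partial_sum (I : Type) (r : seq I) (P : pred I) (h : I -> 'rV[R]_n -> R) k x :
  (forall i, P i -> differentiable (h i) x) ->
  partial k (fun y => \sum_(i <- r | P i) h i y) x = \sum_(i <- r | P i) partial k (h i) x.
Proof.
move=> dh; elim: r => [|j r IH].
  rewrite big_nil (_ : (fun _ => _) = cst 0) ?partial_cst //.
  by apply/funext => y; rewrite big_nil.
rewrite big_cons; have [Pj|nPj] := boolP (P j); last first.
  rewrite -IH; congr (partial _ _ _).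
  by apply/funext => y; rewrite big_cons (negbTE nPj).
rewrite (_ : (fun _ => _) = fun y => h j y + \sum_(i <- r | P i) h i y).
  by rewrite partialD ?IH//; [exact: dh|exact: differentiable_sumf].
by apply/funext => y; rewrite big_cons Pj.
Qed.

Lemma partialZ (k : R) f i x : differentiable f x ->
  partial i (fun y => k * f y) x = k * partial i f x.
Proof.
by move=> df; rewrite partialM// partial_cst mul0r add0r.
Qed.

Lemma differentiable_row (V : normedModType R) m (G : V -> 'rV[R]_m) (x : V) :
  (forall i, differentiable (fun y => G y 0 i) x) -> differentiable G x.
Proof.
move=> dG.
have -> : G = \sum_(i < m) (fun y => G y 0 i *: delta_mx 0 i).
  by apply/funext => y; rewrite fct_sumE -row_sum_delta.
by apply: differentiable_sum => i; exact: differentiableZl.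
Qed.

Lemma diff_coord i x (w : 'rV[R]_n) : 'd (fun y : 'rV[R]_n => y 0 i) x w = w 0 i.
Proof.
have ll : linear (fun y : 'rV[R]_n => y 0 i : R^o) by move=> k y z; rewrite !mxE.
pose aux := GRing.isLinear.Build R 'rV[R]_n R^o *:%R _ ll.
pose L : {linear 'rV[R]_n -> R^o} := HB.pack (fun y : 'rV[R]_n => y 0 i : R^o) aux.
by rewrite (_ : 'd _ x = L :> (_ -> _))//; apply: (@diff_lin _ _ _ L); exact: coord_continuous.
Qed.

Lemma partial_coord i j x : partial i (fun y => y 0 j) x = (i == j)%:R.
Proof.
by rewrite partialE ?diff_coord ?mxE ?eqxx 1?eq_sym//; exact: differentiable_coord.
Qed.

End PartialDerivatives.

Lemma partial_comp (R : realType) n m (f : 'rV[R]_m -> R) (G : 'rV[R]_n -> 'rV[R]_m) a x :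
  differentiable f (G x) -> (forall i, differentiable (fun y => G y 0 i) x) ->
  partial a (f \o G) x = \sum_i partial i f (G x) * partial a (fun y => G y 0 i) x.
Proof.
move=> df dG; have dGx := differentiable_row dG.
rewrite partialE; last exact: differentiable_comp.
rewrite diff_comp//= diff_partial//; apply: eq_bigr => i _; rewrite mulrC; congr (_ * _).
rewrite partialE//.
have dc : differentiable (fun z : 'rV[R]_m => z 0 i) (G x) by exact: differentiable_coord.
rewrite (_ : (fun y => G y 0 i) = (fun z : 'rV[R]_m => z 0 i) \o G)//.
by rewrite [in RHS](diff_comp dGx dc) /= diff_coord.
Qed.

(** * Closure properties of smooth functions on an open set *)

Section Smooth.
Variables (R : realType) (n : nat) (A : set 'rV[R]_n).
Hypothesis oA : open A.
Implicit Types (f g : 'rV[R]_n -> R).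

(** The last index of the list is the one differentiated first, so lists are split at their right
    end. *)
Lemma smooth_onP f : smooth_on A f <->
  (forall x, A x -> differentiable f x) /\ forall i, smooth_on A (partial i f).
Proof.
split=> [sf|[df sf] s]; first split=> [x|i s x Ax]; first exact: (sf [::]).
  by have := sf (rcons s i) x Ax; rewrite -cats1 foldr_cat.
case/lastP: s => [//|s i] x Ax; rewrite -cats1 foldr_cat; exact: sf.
Qed.

Lemma smooth_on_differentiable f x : smooth_on A f -> A x -> differentiable f x.
Proof. by move=> sf; exact: (sf [::]). Qed.

Lemma smooth_on_partial f i : smooth_on A f -> smooth_on A (partial i f).
Proof. by case/smooth_onP. Qed.

Lemma open_near_eq f g x : {in A, f =1 g} -> A x -> {near x, f =1 g}.
Proof.
move=> fg Ax; have : nbhs x A by exact: open_nbhs_nbhs.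
by apply: filterS => y Ay; apply: fg; rewrite inE.
Qed.

(** Equality on an open set is equality near each of its points, so it passes to all iterated
    partial derivatives. *)
Lemma eq_smooth_on f g : {in A, f =1 g} -> smooth_on A f -> smooth_on A g.
Proof.
move=> fg sf s x Ax; apply: near_eq_differentiable (sf s x Ax).
apply: open_near_eq => // {x Ax}.
elim: s => [//|i s IH] x; rewrite inE => Ax /=.
by apply: near_eq_partial; exact: open_near_eq.
Qed.

(** Grading smoothness by the order of differentiation makes products accessible to induction: a
    derivative of a product is a sum of two products, to which the induction hypothesis applies at
    one order less. *)
Fixpoint smooth_upto k f : Prop :=
  (forall x, A x -> differentiable f x) /\
  if k is k'.+1 then forall i, smooth_upto k' (partial i f) else True.

Lemma smooth_uptoP f : smooth_on A f <-> forall k, smooth_upto k f.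
Proof.
split=> [sf k|].
  elim: k f sf => [|k IH] f /smooth_onP[df sf] /=; split=> // i; exact: IH.
move=> sf s; elim/last_ind: s f sf => [|s i IH] f sf x Ax.
  by have [df _] := sf 0; exact: df.
rewrite -cats1 foldr_cat; apply: IH => // k; have [_ ] := sf k.+1; exact.
Qed.

Lemma smooth_uptoW k f : smooth_upto k.+1 f -> smooth_upto k f.
Proof.
elim: k f => [|k IH] f [df sf] /=; split=> // i; apply: IH; exact: sf.
Qed.

Lemma eq_smooth_upto k f g : {in A, f =1 g} -> smooth_upto k f -> smooth_upto k g.
Proof.
elim: k f g => [|k IH] f g fg [df sf] /=;
  (split=> [x Ax|];
    first by apply: near_eq_differentiable (df x Ax); exact: open_near_eq) => // i.
apply: IH (sf i) => x; rewrite inE => Ax; apply: near_eq_partial; exact: open_near_eq.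
Qed.

Lemma smooth_uptoD k f g : smooth_upto k f -> smooth_upto k g ->
  smooth_upto k (fun x => f x + g x).
Proof.
elim: k f g => [|k IH] f g [df sf] [dg sg] /=;
  (split=> [x Ax|]; first by apply: differentiableD; [exact: df|exact: dg]) => // i.
apply: eq_smooth_upto (IH _ _ (sf i) (sg i)) => x; rewrite inE => Ax.
by rewrite partialD//; [exact: df|exact: dg].
Qed.

(** In the Leibniz rule the undifferentiated factor still has order [k.+1] and is brought down to
    [k] by [smooth_uptoW]. *)
Lemma smooth_uptoM k f g : smooth_upto k f -> smooth_upto k g ->
  smooth_upto k (fun x => f x * g x).
Proof.
elim: k f g => [|k IH] f g Hf Hg; have [df sf] := Hf; have [dg sg] := Hg;
  (split=> [x Ax|]; first by apply: differentiableM; [exact: df|exact: dg]) => // i.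
apply: (@eq_smooth_upto _ (fun x => partial i f x * g x + f x * partial i g x)).
  by move=> x; rewrite inE => Ax; rewrite (partialM _ (df _ Ax) (dg _ Ax)).
apply: smooth_uptoD; apply: IH; [exact: sf|exact: smooth_uptoW|exact: smooth_uptoW|exact: sg].
Qed.

Lemma smooth_onD f g : smooth_on A f -> smooth_on A g ->
  smooth_on A (fun x => f x + g x).
Proof.
by move=> /smooth_uptoP sf /smooth_uptoP sg; apply/smooth_uptoP => k; exact: smooth_uptoD.
Qed.

Lemma smooth_onM f g : smooth_on A f -> smooth_on A g ->
  smooth_on A (fun x => f x * g x).
Proof.
by move=> /smooth_uptoP sf /smooth_uptoP sg; apply/smooth_uptoP => k; exact: smooth_uptoM.
Qed.

Lemma smooth_on_cst (k : R) : smooth_on A (fun=> k).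
Proof.
apply/smooth_uptoP => m; elim: m k => [|m IH] k /=; (split=> [x Ax|]; first exact: differentiable_cst) => // i.
by apply: eq_smooth_upto (IH 0) => x _; rewrite partial_cst.
Qed.

Lemma smooth_on_sum (I : Type) (r : seq I) (P : pred I) (h : I -> 'rV[R]_n -> R) :
  (forall i, P i -> smooth_on A (h i)) ->
  smooth_on A (fun x => \sum_(i <- r | P i) h i x).
Proof.
move=> sh; elim: r => [|j r IH].
  by apply: eq_smooth_on (smooth_on_cst 0) => x _; rewrite big_nil.
have [Pj|nPj] := boolP (P j).
  by apply: eq_smooth_on (smooth_onD (sh j Pj) IH) => x _; rewrite big_cons Pj.
by apply: eq_smooth_on IH => x _; rewrite big_cons (negbTE nPj).
Qed.

Lemma smooth_onS (B : set 'rV[R]_n) f : B `<=` A -> smooth_on A f -> smooth_on B f.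
Proof. by move=> BA sf s x /BA; exact: sf. Qed.

End Smooth.

(** * Restriction to lines and symmetry of second derivatives *)

Section Lines.
Variables (R : realType) (n : nat).
Implicit Types (f : 'rV[R]_n -> R) (x y w : 'rV[R]_n).

Lemma is_derive_line f y w s : derivable f (y + s *: w) w ->
  is_derive s 1 (fun t => f (y + t *: w)) ('D_w f (y + s *: w)).
Proof.
move=> df; have E : (fun h : R => h^-1 *: (f (y + (h *: 1 + s) *: w) - f (y + s *: w))) =
    (fun h : R => h^-1 *: (f (h *: w + (y + s *: w)) - f (y + s *: w))).
  apply/funext => h; congr (_ *: (f _ - _)).
  by rewrite [h *: 1]mulr1 scalerDl addrCA.
by apply: DeriveDef; rewrite /derivable /derive /= E.
Qed.

Lemma mvt_line f y w h : 0 < h ->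
  (forall s, 0 <= s <= h -> derivable f (y + s *: w) w) ->
  exists2 c, 0 < c < h & f (y + h *: w) - f y = h * 'D_w f (y + c *: w).
Proof.
move=> h0 df.
have [||c] := @MVT _ (fun t => f (y + t *: w)) (fun t => 'D_w f (y + t *: w)) 0 h h0.
- move=> s; rewrite in_itv /= => /andP[s0 sh]; apply: is_derive_line.
  by apply: df; rewrite !ltW.
- apply: derivable_within_continuous => s; rewrite in_itv /= => sh.
  by have [] := is_derive_line (df s sh).
by rewrite in_itv /= subr0 scale0r addr0 mulrC => ch E; exists c.
Qed.

Lemma norm_delta_row (i : 'I_n) : `|delta_mx 0 i : 'rV[R]_n| <= 1.
Proof.
rewrite /Num.Def.normr /= mx_normrE; apply: bigmax_le => // -[j k] _ /=.
by rewrite mxE ger0_norm ?ler0n// lern1; case: (_ && _).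
Qed.

Lemma norm_coord_le (x : 'rV[R]_n) i : `|x 0 i| <= `|x|.
Proof.
rewrite [leRHS]/Num.Def.normr /= mx_normrE.
exact: (le_bigmax _ (fun ij : 'I_1 * 'I_n => `|x ij.1 ij.2|) (0, i)).
Qed.

Lemma derive_shift_arg f x v w : 'D_w (fun y => f (y + v)) x = 'D_w f (x + v).
Proof. by rewrite /derive /=; under eq_fun do rewrite /= -addrA. Qed.

(** The mean value theorem is applied twice: to [F], the increment of [f] along the j-th axis, on a
    segment in the i-th direction, then to [partial i f] in the j-th direction. Up to reordering its
    terms, the left-hand side is symmetric in [i] and [j]. *)
Lemma second_difference f (A : set 'rV[R]_n) x i j r h :
  (forall y, A y -> differentiable f y) ->
  (forall y, A y -> differentiable (partial i f) y) ->
  (forall y, `|y - x| < r -> A y) -> 0 < h -> h *+ 2 < r ->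
  exists2 y, `|y - x| < h *+ 2 &
    f (x + h *: delta_mx 0 i + h *: delta_mx 0 j) - f (x + h *: delta_mx 0 i)
    - (f (x + h *: delta_mx 0 j) - f x) = h * (h * partial j (partial i f) y).
Proof.
move=> df dif ball h0 hr.
have nD s t : 0 <= s <= h -> 0 <= t <= h ->
    `|x + s *: delta_mx 0 i + t *: delta_mx 0 j - x| <= s + t.
  move=> /andP[s0 _] /andP[t0 _]; rewrite addrC !addrA addNr add0r.
  rewrite (le_trans (ler_normD _ _))// !normrZ !ger0_norm// lerD//.
    by rewrite ler_piMr// norm_delta_row.
  by rewrite ler_piMr// norm_delta_row.
have inA s t : 0 <= s <= h -> 0 <= t <= h -> A (x + s *: delta_mx 0 i + t *: delta_mx 0 j).
  move=> hs ht; apply/ball/(le_lt_trans (nD _ _ hs ht))/(le_lt_trans _ hr).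
  by rewrite mulr2n; case/andP: hs => _ ?; case/andP: ht => _ ?; exact: lerD.
have h00 : 0 <= (0 : R) <= h by rewrite lexx ltW.
have hh : 0 <= h <= h by rewrite lexx ltW.
pose F y := f (y + h *: delta_mx 0 j) - f y.
have dF s : 0 <= s <= h -> derivable F (x + s *: delta_mx 0 i) (delta_mx 0 i).
  move=> hs; apply: derivableB; apply: diff_derivable.
    apply: differentiable_comp => //.
    exact/df/inA.
  by apply: df; have := inA s 0 hs h00; rewrite scale0r addr0.
have [c /andP[c0 ch] EF] := mvt_line h0 dF.
have hc : 0 <= c <= h by rewrite !ltW.
have [s hs|e /andP[e0 eh] EG] :=
  @mvt_line (partial i f) (x + c *: delta_mx 0 i) (delta_mx 0 j) h h0.
  by apply: diff_derivable; exact/dif/inA.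
have he : 0 <= e <= h by rewrite !ltW.
exists (x + c *: delta_mx 0 i + e *: delta_mx 0 j).
  by rewrite (le_lt_trans (nD _ _ hc he))// mulr2n ltrD.
rewrite -EG; apply: etrans EF _; congr (_ * _).
rewrite deriveB; last first.
- by apply/diff_derivable/df; have := inA c 0 hc h00; rewrite scale0r addr0.
- apply: diff_derivable; apply: differentiable_comp => //; exact/df/inA.
by rewrite derive_shift_arg.
Qed.

(** The same second difference equals [h * h] times either mixed derivative, each taken at some
    point close to [x]; continuity of both at [x] then makes them agree there. *)
Lemma partial_comm f (A : set 'rV[R]_n) x i j : open A -> A x -> smooth_on A f ->
  partial i (partial j f) x = partial j (partial i f) x.
Proof.
move=> oA Ax sf.
have df y : A y -> differentiable f y by exact: smooth_on_differentiable.
have d1 k y : A y -> differentiable (partial k f) y.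
  exact/smooth_on_differentiable/smooth_on_partial.
have d2 k l : differentiable (partial k (partial l f)) x.
  exact/smooth_on_differentiable/Ax/smooth_on_partial/smooth_on_partial.
have /nbhs_normP[r /= r0 rA] : nbhs x A by exact: open_nbhs_nbhs.
have ball y : `|y - x| < r -> A y by move=> yx; apply: rA; rewrite /= distrC.
apply/eqP; rewrite -subr_eq0 -normr_le0; apply/ler_addgt0Pr => e e0; rewrite add0r.
have e20 : 0 < e / 2 by rewrite divr_gt0.
have tri (p q z : R) : `|q - z| < e / 2 -> `|p - z| < e / 2 -> `|p - q| <= e.
  move=> qz pz; rewrite (le_trans (ler_distD z _ _))// [leRHS]splitr lerD ?ltW//.
  by rewrite distrC.
have C k l : \forall y \near x,
    `|partial k (partial l f) x - partial k (partial l f) y| < e / 2.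
  have /differentiable_continuous/cvgrPdist_lt/(_ _ e20) := d2 k l; exact.
have /nbhs_normP[q1 /= q10 Q1] := C i j.
have /nbhs_normP[q2 /= q20 Q2] := C j i.
(* The intermediate points lie within [h *+ 2] of [x], so a quarter of the smallest radius keeps
   them strictly inside all three balls. *)
pose h := Num.min r (Num.min q1 q2) / 4.
have m0 : 0 < Num.min r (Num.min q1 q2) by rewrite !lt_min r0 q10 q20.
have h0 : 0 < h by rewrite divr_gt0.
have h2 : h *+ 2 < Num.min r (Num.min q1 q2) by rewrite /h; lra.
move: h2; rewrite !lt_min => /and3P[hr hq1 hq2].
have [y1 y1x E1] := second_difference j df (d1 i) ball h0 hr.
have [y2 y2x E2] := second_difference i df (d1 j) ball h0 hr.
have : partial j (partial i f) y1 = partial i (partial j f) y2.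
  apply: (mulfI (lt0r_neq0 h0)); apply: (mulfI (lt0r_neq0 h0)).
  apply: etrans (esym E1) (etrans _ E2).
  by rewrite !opprB addrACA [RHS]addrACA (addrAC x); congr (_ + _); exact: addrC.
have := Q1 y2; have := Q2 y1; rewrite /= ![`|x - _|]distrC => /(_ (lt_trans y1x hq2)) K1.
move=> /(_ (lt_trans y2x hq1)) K2 E; rewrite E in K1.
exact: (tri _ _ _ K1 K2).
Qed.

End Lines.

(** * The Poincare lemma for 1-forms on a ball *)

Lemma differentiable_approx (R : realType) (V W : normedModType R) (f : V -> W) (x : V)
    (L : {linear V -> W}) : continuous L ->
  (forall e, 0 < e -> \forall h \near 0, `|f (h + x) - f x - L h| <= e * `|h|) ->
  differentiable f x.
Proof.
move=> cL HL; have EL : f \o shift x = cst (f x) + L +o_ 0 id.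
  apply/eqaddoP => e /HL; apply: filterS => h /=.
  by rewrite !fctE /= opprD addrA.
by apply/diff_locallyP; rewrite (diff_unique cL EL).
Qed.

Section Poincare.
Variables (R : realType) (n : nat).
Implicit Types (f : 'rV[R]_n -> R) (x y z a h : 'rV[R]_n) (w : 'I_n -> 'rV[R]_n -> R).

(** On the segment from [x] to [x + h] the mean value theorem gives the increment as [w] at an
    intermediate point paired with [h]; continuity of [w] replaces that point by [x] with an error
    o(h). *)
Lemma differentiable_gradient f w x :
  (\forall y \near x, forall h, derivable f y h /\ 'D_h f y = \sum_i h 0 i * w i y) ->
  (forall i, {for x, continuous (w i)}) -> differentiable f x.
Proof.
move=> Df cw.
(* The candidate differential enters as ['d l 0], which already carries the structure of a linear
   map and is continuous. *)
pose l h := \sum_i h 0 i * w i x.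
have dl : differentiable l (0 : 'rV[R]_n).
  by apply: differentiable_sumf => i _; apply: differentiableM => //; exact: differentiable_coord.
have El h : 'd l (0 : 'rV[R]_n) h = l h.
  rewrite diff_partial//; apply: eq_bigr => i _; congr (_ * _).
  rewrite partial_sum; last first.
    by move=> j _; apply: differentiableM => //; exact: differentiable_coord.
  rewrite (bigD1 i)//= big1 => [|j ji]; rewrite partialM ?partial_cst ?partial_coord//;
    try exact: differentiable_coord.
    by rewrite eqxx mul1r mulr0 !addr0.
  by rewrite eq_sym (negbTE ji) mul0r mulr0 addr0.
have cL := diff_continuous dl.
apply: differentiable_approx cL _ => e e0.
  (* The error is a sum of [n] terms; dividing by [n.+1] instead of [n] covers the case [n = 0]. *)
  have e1 : 0 < e / n.+1%:R by rewrite divr_gt0.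
  have near_w : \forall y \near x, forall i, `|w i x - w i y| < e / n.+1%:R.
    apply: (@filter_forall _ _ (fun i y => `|w i x - w i y| < e / n.+1%:R) (nbhs x) _) => i.
    have /cvgrPdist_lt := cw i; exact.
  have /nbhs_normP[r /= r0 Hr] : \forall y \near x,
      (forall h, derivable f y h /\ 'D_h f y = \sum_i h 0 i * w i y) /\
      forall i, `|w i x - w i y| < e / n.+1%:R by exact: filterI.
  apply/nbhs_normP; exists r => // h /=; rewrite sub0r normrN => hr.
  have inr s : 0 <= s <= 1 -> `|x - (x + s *: h)| < r.
    move=> /andP[s0 s1]; rewrite opprD addrA subrr sub0r normrN normrZ ger0_norm//.
    by rewrite (le_lt_trans _ hr)// ler_piMl.
  have [|c /andP[c0 c1]] := @mvt_line _ _ f x h 1 ltr01.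
    by move=> s /inr/Hr[D _]; have [] := D h.
  rewrite scale1r mul1r => E.
  have /inr/Hr[D W] : 0 <= c <= 1 by rewrite !ltW.
  rewrite El [h + x]addrC.
  rewrite E (D h).2 /l -sumrB.
  rewrite (le_trans (ler_norm_sum _ _ _))//.
  apply: (@le_trans _ _ (\sum_(i < n) `|h| * (e / n.+1%:R))).
    apply: ler_sum => i _; rewrite -mulrBr normrM ler_pM ?norm_coord_le//.
    by rewrite distrC ltW.
rewrite sumr_const card_ord -mulrnAr [leRHS]mulrC ler_wpM2l//.
by rewrite -[leLHS]mulr_natr mulrAC ler_pdivrMr ?ltr0n// ler_wpM2l ?ler_nat// ltW.
Qed.

Section Ball.
Variables (w : 'I_n -> 'rV[R]_n -> R) (a : 'rV[R]_n) (r M : R).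
Let D := [set y | `|y - a| < r].
Hypothesis dw : forall i y, D y -> differentiable (w i) y.
Hypothesis cdw : forall i j y, D y -> {for y, continuous (partial j (w i))}.
Hypothesis closed_w : forall i j y, D y -> partial j (w i) y = partial i (w j) y.
Hypothesis ub_w : forall i y, D y -> `|w i y| <= M.
Hypothesis ub_dw : forall i j y, D y -> `|partial j (w i) y| <= M.

Definition radial_potential x : R :=
  \int[lebesgue_measure]_(t in `[0%R, 1%R]) \sum_i w i (a + t *: (x - a)) * (x - a) 0 i.

Let D_segment x (t : R) : D x -> 0 <= t <= 1 -> D (a + t *: (x - a)).
Proof.
move=> Dx /andP[t0 t1]; rewrite /D /= addrC addKr normrZ ger0_norm//.
by rewrite (le_lt_trans _ Dx)// ler_piMl.
Qed.

Let k x t := \sum_i w i (a + t *: (x - a)) * (x - a) 0 i.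

Let k_integrable x : D x ->
  lebesgue_measure.-integrable `[0%R, 1%R] (EFin \o k x).
Proof.
move=> Dx; apply: continuous_compact_integrable; first exact: segment_compact.
apply: derivable_within_continuous => t; rewrite in_itv /= => t01.
rewrite /k; apply/derivable1_diffP.
rewrite (_ : (fun t => _) = \sum_(i < n) (fun t : R => w i (a + t *: (x - a)) * (x - a) 0 i)).
  apply: differentiable_sum => i; apply: differentiableM => //.
  apply/derivable1_diffP.
  have [] // := @is_derive_line _ _ (w i) a (x - a) t _.
  by apply: diff_derivable; apply: dw; exact: D_segment.
by apply/funext => u; rewrite fct_sumE.
Qed.

(* The derivative of the integrand in the direction h; closedness of w makes it
   the derivative of t * <w (a + t (x - a)), h> in t. *)
Let dk x h t := \sum_i ((\sum_j t * h 0 j * partial j (w i) (a + t *: (x - a))) * (x - a) 0 i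
   + w i (a + t *: (x - a)) * h 0 i).

Let is_derive_k x h (t s : R) : D (x + s *: h) -> 0 <= t <= 1 ->
  is_derive s 1 (fun s => k (x + s *: h) t) (dk (x + s *: h) h t).
Proof.
move=> Ds t01.
rewrite (_ : (fun s => _) = \sum_(i < n) (fun s => w i (a + t *: (x + s *: h - a)) * (x + s *: h - a) 0 i)); last first.
  by apply/funext => u; rewrite fct_sumE.
apply: is_derive_sum => i.
have W : is_derive s 1 (fun s => w i (a + t *: (x + s *: h - a)))
    (\sum_j t * h 0 j * partial j (w i) (a + t *: (x + s *: h - a))).
  (* As the parameter varies, the argument of [w i] runs along a line of direction [t *: h], whence
     the factor [t] in [dk]. *)
  have E u : a + t *: (x + u *: h - a) = a + t *: (x - a) + u *: (t *: h).
    by rewrite addrAC scalerDr !scalerA [t * u]mulrC addrA.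
  rewrite (_ : (fun s => _) = fun u => w i (a + t *: (x - a) + u *: (t *: h))); last first.
    by apply/funext => u; rewrite E.
  have dwi : differentiable (w i) (a + t *: (x - a) + s *: (t *: h)).
    by rewrite -E; apply: dw; exact: D_segment.
  have := is_derive_line (diff_derivable (v := t *: h) dwi); rewrite derive_partial// -E.
  by under eq_bigr do rewrite mxE.
have Z : is_derive s 1 (fun s => (x + s *: h - a) 0 i) (h 0 i).
  rewrite (_ : (fun s => _) = (fun s => (x - a) 0 i + s * h 0 i)); last first.
    by apply/funext => u; rewrite !mxE; ring.
  apply: is_derive_eq.
  by rewrite add0r mul1r scaler0 add0r [_%:A]mulr1.
apply: is_derive_eq.
by rewrite /GRing.scale/= addrC [X in X + _ = _]mulrC.
Qed.

Let dk_primitive x h (t : R) : D x -> 0 <= t <= 1 ->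
  is_derive t 1 (fun t => t * \sum_i w i (a + t *: (x - a)) * h 0 i) (dk x h t).
Proof.
move=> Dx t01.
have Dt := D_segment Dx t01.
have W i : is_derive t 1 (fun t => w i (a + t *: (x - a)))
    (\sum_j (x - a) 0 j * partial j (w i) (a + t *: (x - a))).
  have := is_derive_line (diff_derivable (v := x - a) (dw i Dt)).
  by rewrite derive_partial//; exact: dw.
rewrite (_ : (fun t => _) = (fun t => t * (\sum_(i < n) (fun t => w i (a + t *: (x - a)) * h 0 i)) t)); last first.
  by apply/funext => u; rewrite fct_sumE.
apply: is_derive_eq.
rewrite fct_sumE /dk [_%:A]mulr1 [in RHS]big_split /=; congr (_ + _).
rewrite -[LHS]/(_ * _) mulr_sumr.
rewrite (eq_bigr (fun i => \sum_j t * (h 0 i * ((x - a) 0 j *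
    partial j (w i) (a + t *: (x - a)))))); last first.
  by move=> i _; rewrite scaler0 add0r -[_ *: _]/(_ * _) !mulr_sumr.
rewrite [RHS](eq_bigr (fun i => \sum_j t * h 0 j * partial j (w i) (a + t *: (x - a)) *
    (x - a) 0 i)); last by move=> i _; rewrite mulr_suml.
rewrite exchange_big; apply: eq_bigr => i _; apply: eq_bigr => j _ /=.
by rewrite (closed_w i j Dt); ring.
Qed.

Let dk_continuous x h (t : R) : D x -> 0 <= t <= 1 -> {for t, continuous (dk x h)}.
Proof.
move=> Dx t01; have Dt := D_segment Dx t01.
have L (f : 'rV[R]_n -> R) : {for a + t *: (x - a), continuous f} ->
    f (a + u *: (x - a)) @[u --> t] --> f (a + t *: (x - a)).
  move=> cf; apply: (@cvg_comp _ _ _ (fun u : R => a + u *: (x - a)) f _ _ _ _ cf).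
  by apply: cvgD; [exact: cvg_cst|exact: scalel_continuous].
rewrite /continuous_at /dk; apply: cvg_big => [|i _]; first exact: add_continuous.
apply: cvgD; (apply: cvgM; last exact: cvg_cst); last first.
  by apply: L; apply: differentiable_continuous; exact: dw.
apply: cvg_big => [|j _]; first exact: add_continuous.
apply: cvgM; last by apply: L; exact: cdw.
by apply: cvgM; [exact: cvg_id|exact: cvg_cst].
Qed.

(** Differentiation under the integral sign along [x + s *: h] gives the integral of [dk x h] over
    [0, 1]. By [dk_primitive] it is the increment of t * <w (a + t (x - a)), h>, which is 0 at t = 0
    and <w x, h> at t = 1. *)
Lemma derive_radial_potential x h : D x ->
  derivable radial_potential x h /\ 'D_h radial_potential x = \sum_i h 0 i * w i x.
Proof.
move=> Dx.
(* For |s| < e the point [x + s *: h] stays in the ball; the added 1 allows [h = 0]. *)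
pose e := (r - `|x - a|) / (`|h| + 1).
have h1 : 0 < `|h| + 1 by rewrite ltr_wpDl.
have e0 : 0 < e by rewrite divr_gt0// subr_gt0.
have He (s : R) : s \in `]-e, e[ -> D (x + s *: h).
  rewrite in_itv /= -ltr_norml => se; rewrite /D /= addrAC.
  rewrite (le_lt_trans (ler_normD _ _))// normrZ -ltrBrDl.
  apply: (@le_lt_trans _ _ (`|s| * (`|h| + 1))); first by rewrite ler_wpM2l// lerDl.
  by rewrite -ltr_pdivlMr.
have le001 : 0 <= (0 : R) <= 1 by rewrite lexx ler01.
have le011 : 0 <= (1 : R) <= 1 by rewrite lexx ler01.
have I0 : `]-e, e[%classic (0 : R) by rewrite /= in_itv /= oppr_lt0 e0.
(* A constant dominating [dk] over the whole ball and all t in [0, 1], obtained from the bounds [M]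
   on [w] and its derivatives and from |x - a| < r. *)
pose C := \sum_(i < n) ((\sum_(j < n) `|h| * `|M|) * r + `|M| * `|h|).
have r0 : 0 < r by exact: le_lt_trans Dx.
have C0 : 0 <= C.
  apply: sumr_ge0 => i _; rewrite addr_ge0 ?mulr_ge0 ?(ltW r0)//.
  by apply: sumr_ge0 => j _; rewrite mulr_ge0.
have dkC y t : D y -> 0 <= t <= 1 -> `|dk y h t| <= C.
  move=> Dy t01; have Dt := D_segment Dy t01; case/andP: t01 => t0 t1.
  rewrite (le_trans (ler_norm_sum _ _ _))//; apply: ler_sum => i _.
  rewrite (le_trans (ler_normD _ _))// !normrM lerD//; last first.
    by rewrite ler_pM ?norm_coord_le// (le_trans (ub_w _ Dt))// ler_norm.
  rewrite ler_pM//; last by rewrite (le_trans (norm_coord_le _ _))// ltW.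
  rewrite (le_trans (ler_norm_sum _ _ _))//; apply: ler_sum => j _.
  rewrite !normrM ler_pM ?mulr_ge0//; last by rewrite (le_trans (ub_dw _ _ Dt))// ler_norm.
  by rewrite (ger0_norm t0) -[leRHS]mul1r ler_pM ?norm_coord_le.
have D1 s t : `]-e, e[%classic s -> `[0%R, 1%R]%classic t ->
    partial1of2 (fun s t => k (x + s *: h) t) s t = dk (x + s *: h) h t.
  move=> /He Ds; rewrite /= in_itv /= => t01; rewrite partial1of2E.
  by have [_ ->] := is_derive_k Ds t01.
have cvgF : u^-1 *: (radial_potential (u *: h + x) - radial_potential x) @[u --> 0^'] -->
    \int[lebesgue_measure]_(t in `[0%R, 1%R]) dk x h t.
  have -> : \int[lebesgue_measure]_(t in `[0%R, 1%R]) dk x h t =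
      \int[lebesgue_measure]_(t in `[0%R, 1%R]) partial1of2 (fun s t => k (x + s *: h) t) 0 t.
    apply: eq_Rintegral => t; rewrite inE => t01; rewrite D1//.
    by rewrite scale0r addr0.
  have -> : (fun u : R => u^-1 *: (radial_potential (u *: h + x) - radial_potential x)) =
      (fun u : R => u^-1 *: (\int[lebesgue_measure]_(t in `[0%R, 1%R]) k (x + (u + 0) *: h) t -
          \int[lebesgue_measure]_(t in `[0%R, 1%R]) k (x + 0 *: h) t)).
    by apply/funext => u; rewrite addr0 scale0r addr0 [u *: h + x]addrC.
  apply: (@cvg_differentiation_under_integral R _ _ lebesgue_measure
    (fun s t => k (x + s *: h) t) `[0%R, 1%R]%classic (measurable_itv _) 0 (- e) e I0 _ _ (cst C)).
  - by move=> s /He Ds; exact: k_integrable.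
  - move=> s t /He Ds; rewrite /= in_itv /= => t01.
    by have [] := is_derive_k Ds t01.
  - by [].
  - apply: continuous_compact_integrable; first exact: segment_compact.
    by apply: continuous_subspaceT => y; exact: cst_continuous.
  - move=> s t Is t01; rewrite D1//; apply: dkC; first exact: He.
    by move: t01; rewrite /= in_itv.
have EI : \int[lebesgue_measure]_(t in `[0%R, 1%R]) dk x h t = \sum_i h 0 i * w i x.
  rewrite /Rintegral (@continuous_FTC2 _ _ (fun t => t * \sum_i w i (a + t *: (x - a)) * h 0 i) 0 1)//.
  - rewrite /= mul0r subr0 mul1r; apply: eq_bigr => i _.
    by rewrite scale1r subrKC mulrC.
  - apply: continuous_in_subspaceT => t; rewrite inE /= in_itv /= => t01.
    exact: dk_continuous.
  - split.
    + move=> t; rewrite in_itv /= => /andP[t0 t1].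
      have t01 : 0 <= t <= 1 by rewrite !ltW.
      by have [] := dk_primitive h Dx t01.
    + apply: cvg_at_right_filter.
      have [D0 _] := dk_primitive h Dx le001.
      by have /derivable1_diffP/differentiable_continuous := D0.
    + apply: cvg_at_left_filter.
      have [D0 _] := dk_primitive h Dx le011.
      by have /derivable1_diffP/differentiable_continuous := D0.
  - move=> t; rewrite in_itv /= => /andP[t0 t1]; rewrite derive1E.
    have t01 : 0 <= t <= 1 by rewrite !ltW.
    by have [_ ->] := dk_primitive h Dx t01.
rewrite EI in cvgF.
split; first by apply/cvg_ex; exists (\sum_i h 0 i * w i x).
exact/cvg_lim.
Qed.

Lemma radial_potentialP x : D x ->
  differentiable radial_potential x /\ forall i, partial i radial_potential x = w i x.
Proof.
move=> Dx; split=> [|i]; last first.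
  rewrite /partial (derive_radial_potential _ Dx).2 (bigD1 i)//= big1 => [|j ji].
    by rewrite mxE !eqxx mul1r addr0.
  by rewrite mxE (negbTE ji) andbF mul0r.
apply: (@differentiable_gradient _ w).
  apply/nbhs_normP; exists (r - `|x - a|) => [|y /=]; first by rewrite /= subr_gt0.
  rewrite ltrBrDr distrC => yx h; apply: derive_radial_potential.
  by rewrite /D /= (le_lt_trans _ yx)// (le_trans _ (ler_normD _ _))// addrA subrK.
by move=> i; apply: differentiable_continuous; exact: dw.
Qed.
End Ball.

Lemma local_potential (A : set 'rV[R]_n) w a : open A -> A a ->
  (forall i, smooth_on A (w i)) ->
  (forall i j y, A y -> partial j (w i) y = partial i (w j) y) ->
  exists2 r, 0 < r & exists psi, forall y, `|y - a| < r ->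
    [/\ A y, differentiable psi y & forall i, partial i psi y = w i y].
Proof.
move=> oA Aa sw cw.
have dw i y : A y -> differentiable (w i) y by exact: smooth_on_differentiable.
have ddw i j y : A y -> differentiable (partial j (w i)) y.
  exact/smooth_on_differentiable/smooth_on_partial.
(* [M] strictly exceeds every one of these absolute values at [a], so by continuity it bounds them
   all on a small ball. *)
pose M := 1 + \sum_i `|w i a| + \sum_i \sum_j `|partial j (w i) a|.
have near_le (f : 'rV[R]_n -> R) K : differentiable f a -> `|f a| < K ->
    \forall y \near a, `|f y| <= K.
  move=> df fK; have Ke : 0 < K - `|f a| by rewrite subr_gt0.
  have /differentiable_continuous/cvgrPdist_lt/(_ _ Ke) := df.
  apply: filterS => y; rewrite ltrBrDr distrC => H; rewrite ltW// (le_lt_trans _ H)//.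
  by rewrite (le_trans _ (ler_normD _ _))// subrK.
have S1 : 0 <= \sum_i `|w i a| by exact: sumr_ge0.
have S2 : 0 <= \sum_i \sum_j `|partial j (w i) a|.
  by apply: sumr_ge0 => i _; exact: sumr_ge0.
have nw : \forall y \near a, forall i, `|w i y| <= M.
  apply: (@filter_forall _ _ (fun i y => `|w i y| <= M) (nbhs a) _) => i.
  apply: near_le; first exact: dw.
  rewrite /M [X in 1 + X](bigD1 i)//=.
  have : 0 <= \sum_(j < n | j != i) `|w j a| by exact: sumr_ge0.
  lra.
have ndw : \forall y \near a, forall ij : 'I_n * 'I_n, `|partial ij.2 (w ij.1) y| <= M.
  apply: (@filter_forall _ _ (fun (ij : 'I_n * 'I_n) y => `|partial ij.2 (w ij.1) y| <= M)
    (nbhs a) _) => -[i j] /=.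
  apply: near_le; first exact: ddw.
  rewrite /M [X in _ + X](bigD1 i)//= [X in _ + (X + _)](bigD1 j)//=.
  have : 0 <= \sum_(k < n | k != j) `|partial k (w i) a| by exact: sumr_ge0.
  have : 0 <= \sum_(l < n | l != i) \sum_k `|partial k (w l) a|.
    by apply: sumr_ge0 => l _; exact: sumr_ge0.
  lra.
have nA : \forall y \near a, A y by exact: open_nbhs_nbhs.
have /nbhs_normP[r /= r0 Hr] : \forall y \near a,
    [/\ A y, forall i, `|w i y| <= M & forall ij : 'I_n * 'I_n, `|partial ij.2 (w ij.1) y| <= M].
  by apply: filterS3 nA nw ndw.
have {}Hr y : `|y - a| < r -> [/\ A y, forall i, `|w i y| <= M &
    forall ij : 'I_n * 'I_n, `|partial ij.2 (w ij.1) y| <= M].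
  by rewrite distrC; exact: Hr.
exists r => //; exists (radial_potential w a) => y ya.
have [Ay _ _] := Hr _ ya.
have [|||||dpsi ppsi] := @radial_potentialP w a r M _ _ _ _ _ y ya; last by split.
- by move=> i z /Hr[Az _ _]; exact: dw.
- by move=> i j z /Hr[Az _ _]; apply: differentiable_continuous; exact: ddw.
- by move=> i j z /Hr[Az _ _]; exact: cw.
- by move=> i z /Hr[_ ? _].
- by move=> i j z /Hr[_ _ /(_ (i, j))].
Qed.

End Poincare.

(** * Cup products and pairings in the cohomology of tori *)

Section CohomologyAlgebra.
Variable R : realType.

Section Monomials.
Variable n : nat.

(* The class of dx^(i_1) ... dx^(i_k), I = {i_1 < ... < i_k}; it is 0 if #|I| != k. *)
Definition monomial k (I : {set 'I_n}) : cohom R n k :=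
  [ffun J : ksubset n k => (val J == I)%:R].

Lemma sum_monomial k (I : {set 'I_n}) (F : ksubset n k -> R) (J : ksubset n k) :
  val J = I -> \sum_J' F J' * monomial k I J' = F J.
Proof.
move=> JI; rewrite (bigD1 J)//= big1 => [|J' J'J].
  by rewrite ffunE JI eqxx mulr1 addr0.
rewrite ffunE; case: eqP => [E|]; last by rewrite mulr0.
by case/eqP: J'J; apply: val_inj; rewrite JI.
Qed.

(** A single pair of index sets contributes. When [I] and [J] meet, both sides vanish: their union
    has fewer than [k + l] elements, so no index [K] equals it. *)
Lemma cup_monomial k l (I J : {set 'I_n}) : #|I| = k -> #|J| = l ->
  cup (monomial k I) (monomial l J) = (-1) ^+ inversions I J *: monomial (k + l) (I :|: J)%SET.
Proof.
move=> /eqP cI /eqP cJ; apply/ffunP => K; rewrite !ffunE.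
under eq_bigr => I' _.
  rewrite big_mkcond /= (eq_bigr (fun J' : ksubset n l =>
    (if (val I' :|: val J')%SET == val K then (-1) ^+ inversions (val I') (val J') * monomial k I I'
     else 0) * monomial l J J')); last first.
    by move=> J' _; case: ifP; rewrite ?mul0r// mulrA.
  rewrite (@sum_monomial _ _ _ (exist _ J cJ) erefl) /=; over.
rewrite (eq_bigr (fun I' : ksubset n k =>
    (if (val I' :|: J)%SET == val K then (-1) ^+ inversions (val I') J else 0) * monomial k I I')).
  rewrite (@sum_monomial _ _ _ (exist _ I cI) erefl) /= eq_sym /GRing.scale /=.
  by case: ifP; rewrite ?mulr1 ?mulr0.
by move=> I' _; case: ifP; rewrite ?mul0r.
Qed.

Lemma dxE i : dx R i = monomial 1 [set i]%SET.
Proof. by apply/ffunP => I; rewrite !ffunE. Qed.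

Lemma inversionsE (I J : {set 'I_n}) :
  inversions I J = (\sum_(i in I) \sum_(j in J) (j < i))%N.
Proof.
rewrite /inversions pair_big_dep /= -sum1_card big_mkcond [RHS]big_mkcond /=.
apply: eq_bigr => -[i j] _ /=; rewrite inE /=.
by case: (i \in I); case: (j \in J); case: (j < i)%N.
Qed.

Lemma torus_integral_monomial (I : {set 'I_n}) :
  torus_integral (monomial n I) = (#|I| == n)%:R.
Proof.
have [cI|nI] := boolP (#|I| == n); last first.
  rewrite /torus_integral big1// => -[J /= cJ] _; rewrite ffunE /=.
  by case: eqP => // E; rewrite -E cJ in nI.
have := @sum_monomial n I (fun=> 1) (exist _ I cI) erefl; rewrite /torus_integral => <-.
by apply: eq_bigr => J _; rewrite mul1r.
Qed.

Lemma torus_integralZ (c : R) (a : cohom R n n) : torus_integral (c *: a) = c * torus_integral a.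
Proof. by rewrite /torus_integral mulr_sumr; apply: eq_bigr => I _; rewrite ffunE. Qed.

Lemma torus_integralD (a b : cohom R n n) :
  torus_integral (a + b) = torus_integral a + torus_integral b.
Proof. by rewrite /torus_integral -big_split; apply: eq_bigr => I _; rewrite ffunE. Qed.

Lemma cup_is_linearr k l (a : cohom R n k) (c : R) (b b' : cohom R n l) :
  cup a (c *: b + b') = c *: cup a b + cup a b'.
Proof.
apply/ffunP => K; rewrite !ffunE scaler_sumr -big_split; apply: eq_bigr => I _.
rewrite scaler_sumr -big_split; apply: eq_bigr => J _; rewrite !ffunE /GRing.scale /=; ring.
Qed.

Lemma cup_is_linearl k l (b : cohom R n l) (c : R) (a a' : cohom R n k) :
  cup (c *: a + a') b = c *: cup a b + cup a' b.
Proof.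
apply/ffunP => K; rewrite !ffunE scaler_sumr -big_split; apply: eq_bigr => I _.
rewrite scaler_sumr -big_split; apply: eq_bigr => J _; rewrite !ffunE /GRing.scale /=; ring.
Qed.

Lemma cupZr k l (a : cohom R n k) (c : R) (b : cohom R n l) : cup a (c *: b) = c *: cup a b.
Proof.
apply/ffunP => K; rewrite !ffunE scaler_sumr; apply: eq_bigr => I _.
rewrite scaler_sumr; apply: eq_bigr => J _; rewrite !ffunE /GRing.scale /=; ring.
Qed.

Lemma cupZl k l (a : cohom R n k) (c : R) (b : cohom R n l) : cup (c *: a) b = c *: cup a b.
Proof.
apply/ffunP => K; rewrite !ffunE scaler_sumr; apply: eq_bigr => I _.
rewrite scaler_sumr; apply: eq_bigr => J _; rewrite !ffunE /GRing.scale /=; ring.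
Qed.

End Monomials.

(** Stated for a bare function, so that it serves for either argument of a bilinear operation
    without building a linear structure. *)
Lemma linear_comb (V W : lmodType R) (f : V -> W) : (forall c x y, f (c *: x + y) = c *: f x + f y) ->
  forall m (c : 'I_m -> R) (x : 'I_m -> V), f (\sum_i c i *: x i) = \sum_i c i *: f (x i).
Proof.
move=> lf m c x; have f0 : f 0 = 0.
  by have := lf (-1) 0 0; rewrite scaler0 addr0 scaleN1r addNr.
elim: m c x => [|m IH] c x; first by rewrite !big_ord0.
by rewrite !big_ord_recl lf IH.
Qed.

Lemma proj1_monomial m p k (I : {set 'I_m}) : #|I| = k ->
  @proj1_pullback R m p k (monomial k I) = monomial k (lshift p @: I)%SET.
Proof.
move=> /eqP cI; apply/ffunP => K; rewrite !ffunE big_mkcond /=.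
rewrite (eq_bigr (fun I' : ksubset m k => ((lshift p @: val I')%SET == val K)%:R * monomial k I I')).
  by rewrite (@sum_monomial _ _ _ _ (exist _ I cI) erefl) /= eq_sym.
by move=> I' _; case: eqP; rewrite ?mul1r ?mul0r.
Qed.

Lemma proj2_monomial m p k (I : {set 'I_p}) : #|I| = k ->
  @proj2_pullback R m p k (monomial k I) = monomial k (@rshift m p @: I)%SET.
Proof.
move=> /eqP cI; apply/ffunP => K; rewrite !ffunE big_mkcond /=.
rewrite (eq_bigr (fun I' : ksubset p k => ((@rshift m p @: val I')%SET == val K)%:R * monomial k I I')).
  by rewrite (@sum_monomial _ _ _ _ (exist _ I cI) erefl) /= eq_sym.
by move=> I' _; case: eqP; rewrite ?mul1r ?mul0r.
Qed.

Lemma proj1_is_linear m p k (c : R) (a b : cohom R m k) :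
  @proj1_pullback R m p k (c *: a + b) = c *: proj1_pullback p a + proj1_pullback p b.
Proof.
apply/ffunP => K; rewrite !ffunE scaler_sumr -big_split; apply: eq_bigr => I _.
by rewrite !ffunE.
Qed.

Lemma proj1Z m p k (c : R) (a : cohom R m k) :
  @proj1_pullback R m p k (c *: a) = c *: proj1_pullback p a.
Proof.
by apply/ffunP => K; rewrite !ffunE scaler_sumr; apply: eq_bigr => I _; rewrite !ffunE.
Qed.

Lemma epsilonE (i j k : 'I_3) : epsilon R i j k =
  match val i, val j, val k with
  | 0, 1, 2 | 1, 2, 0 | 2, 0, 1 => 1%R
  | 0, 2, 1 | 1, 0, 2 | 2, 1, 0 => (-1)%R
  | _, _, _ => 0%R
  end%N.
Proof.
by case: i => [[|[|[|i]]]]//= Hi; case: j => [[|[|[|j]]]]//= Hj;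
  case: k => [[|[|[|k]]]]//= Hk;
  rewrite /epsilon -signr_odd /= ?mul0r// mul1r ?expr0 ?expr1.
Qed.

Definition dx2 n (j k : 'I_n) : cohom R n 2 := cup (dx R j) (dx R k).

Lemma sum_set2 n (a b : 'I_n) (F : 'I_n -> nat) : a != b ->
  (\sum_(i in [set a; b]%SET) F i = F a + F b)%N.
Proof. by move=> ab; rewrite big_setU1 ?inE//= big_set1. Qed.

Lemma dx2E n (j k : 'I_n) : j != k ->
  dx2 j k = (-1) ^+ (k < j)%N *: monomial 2 [set j; k]%SET.
Proof.
by move=> jk; rewrite /dx2 !dxE cup_monomial ?cards1// inversionsE !big_set1.
Qed.

Lemma dx2C n (j k : 'I_n) : j != k -> dx2 k j = - dx2 j k.
Proof.
move=> jk; rewrite !dx2E// 1?eq_sym// finset.setUC -scaleNr; congr (_ *: _).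
by move: jk; rewrite -val_eqE /=; case: ltngtP; rewrite ?expr1 ?expr0 ?opprK.
Qed.

(** Valued in [int] because signs of concrete words then evaluate: case analyses over all indices
    end by computation, which real numbers would not allow. *)
Definition perm_sign (s : seq nat) (inv : nat) : int :=
  if uniq s then (if odd inv then -1 else 1) else 0.

Lemma card_uniq_seq n (s : seq 'I_n) : (#|[set x in s]| == size s) = uniq s.
Proof.
by rewrite cardsE; apply/eqP/idP => [/card_uniqP|/card_uniqP].
Qed.

Lemma integral_dx2_dx2 (a b c d : 'I_4) : a != b -> c != d ->
  intersection_form (dx2 a b) (dx2 c d) =
  (perm_sign [:: val a; val b; val c; val d]
     ((b < a) + (d < c) + ((c < a) + (d < a) + ((c < b) + (d < b)))))%:~R.
Proof.
move=> ab cd; rewrite /intersection_form !dx2E//.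
rewrite cupZl cupZr cup_monomial ?cards2 ?ab ?cd// !torus_integralZ torus_integral_monomial.
rewrite inversionsE sum_set2// !sum_set2//.
rewrite (_ : #|_| == 4 = uniq [:: val a; val b; val c; val d]); last first.
  rewrite [RHS](map_inj_uniq val_inj [:: a; b; c; d]) -card_uniq_seq /=.
  congr (_ == _); apply: eq_card => x; rewrite !inE; by rewrite -!orbA.
rewrite /perm_sign; case: uniq; last by rewrite !mulr0.
rewrite mulr1 !mulrA -!exprD -signr_odd.
by case: odd; rewrite ?expr1 ?expr0.
Qed.

Lemma integral_dx_dx2 (a b c : 'I_3) : b != c ->
  torus_integral (cup (dx R a) (dx2 b c)) =
  (perm_sign [:: val a; val b; val c] ((c < b) + ((b < a) + (c < a))))%:~R.
Proof.
move=> bc; rewrite dx2E// dxE.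
rewrite cupZr cup_monomial ?cards1 ?cards2 ?bc// !torus_integralZ torus_integral_monomial.
rewrite inversionsE big_set1 sum_set2//.
rewrite (_ : #|_| == 3 = uniq [:: val a; val b; val c]); last first.
  rewrite [RHS](map_inj_uniq val_inj [:: a; b; c]) -card_uniq_seq /=.
  congr (_ == _); apply: eq_card => x; rewrite !inE; by rewrite -?orbA.
rewrite /perm_sign; case: uniq; last by rewrite !mulr0.
rewrite mulr1 -!exprD -signr_odd.
by case: odd; rewrite ?expr1 ?expr0.
Qed.

(* dx^2 dx^3, dx^3 dx^1 and dx^1 dx^2 *)
Definition star_dx (i : 'I_3) : cohom R 3 2 := dx2 (ordS i) (ordS (ordS i)).

Lemma ordS_neq (i : 'I_3) : (ordS i != ordS (ordS i)) && (i != ordS i) && (i != ordS (ordS i)).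
Proof. by case: i => [[|[|[|]]]]. Qed.

Lemma H2_classE v : H2_class v = \sum_i v 0 i *: star_dx i.
Proof.
apply: eq_bigr => i _.
have E j k : (2^-1 * epsilon R i j k * v 0 i) *: (cup (dx R j) (dx R k) : cohom R 3 2) =
  (2^-1 * v 0 i) *: (epsilon R i j k *: dx2 j k) by rewrite scalerA; congr (_ *: _); ring.
under eq_bigr do under eq_bigr do rewrite E.
under eq_bigr do rewrite -scaler_sumr.
rewrite -scaler_sumr.
(* Only the two orderings of the pair complementary to [i] survive. They contribute equally, since
   [epsilon] and [dx2] both change sign under the exchange, and this cancels the factor [2^-1]. *)
suff -> : \sum_j \sum_k epsilon R i j k *: dx2 j k = star_dx i *+ 2.
  by rewrite mulr2n scalerDr -scalerDl; congr (_ *: _); field.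
rewrite !big_ord_recl !big_ord0 !epsilonE.
have D (a b c d : 'I_3) : val a = val c -> val b = val d -> dx2 a b = dx2 c d.
  by move=> /val_inj -> /val_inj ->.
case: i {E} => [[|[|[|]]]]//= Hi; rewrite !(scale0r, addr0, add0r, scale1r, scaleN1r) mulr2n /star_dx.
- by rewrite -[X in _ + X]dx2C//; congr (_ + _); apply: D.
- by rewrite addrC -[X in _ + X]dx2C//; congr (_ + _); apply: D.
- by rewrite -[X in _ + X]dx2C//; congr (_ + _); apply: D.
Qed.

Lemma H1_classE u : H1_class u = \sum_i u 0 i *: dx R i.
Proof. by []. Qed.

Lemma integral_dx_star (i j : 'I_3) :
  torus_integral (cup (dx R i) (star_dx j)) = (i == j)%:R.
Proof.
rewrite integral_dx_dx2; last by case/andP: (ordS_neq j) => /andP[].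
transitivity (((i == j)%:R : int)%:~R : R); last by case: (i == j).
congr (_%:~R); case: i => [[|[|[|]]]]//= Hi; case: j => [[|[|[|]]]]//= Hj.
Qed.

(** The classes dx^i dt, with dt as the fourth coordinate; the [vertical] classes are the lifts of
    the [star_dx i] to the 4-torus. *)
Definition horizontal (i : 'I_3) : cohom R 4 2 := dx2 (lshift 1 i) (rshift 3 ord0).
Definition vertical (i : 'I_3) : cohom R 4 2 :=
  dx2 (lshift 1 (ordS i)) (lshift 1 (ordS (ordS i))).

(** Each family is isotropic because its members always share a coordinate: dt for the horizontal
    ones, and one of x^1, x^2, x^3 for the vertical ones, two pairs out of three always meeting. The
    mixed sign is positive because dt moves past two 1-forms to reach the last place. *)
Lemma intersection_basis (i j : 'I_3) :
  [/\ intersection_form (horizontal i) (horizontal j) = 0,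
      intersection_form (vertical i) (vertical j) = 0,
      intersection_form (horizontal i) (vertical j) = (i == j)%:R &
      intersection_form (vertical i) (horizontal j) = (i == j)%:R].
Proof.
have H k : lshift 1 (k : 'I_3) != rshift 3 ord0 by case: k => [[|[|[|]]]].
have V (k : 'I_3) : lshift 1 (ordS k) != lshift 1 (ordS (ordS k)).
  by case: k => [[|[|[|]]]].
have I (b : bool) : b%:R = (b%:R : int)%:~R :> R by case: b.
rewrite /horizontal /vertical !integral_dx2_dx2 ?H ?V// !I.
split; try (apply: (congr1 (fun z : int => z%:~R) (y := 0)));
  try (congr (_%:~R)); case: i => [[|[|[|]]]]//= Hi; case: j => [[|[|[|]]]]//= Hj.
Qed.

(** The coefficient at [K], the index pair of dx^i dt, reads u_i off [utilde]; harmonicity of the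
    components thereby yields harmonicity of the u_i. *)
Lemma horizontal_coord (i : 'I_3) : exists K : ksubset 4 2,
  forall j, horizontal j K = (j == i)%:R /\ vertical j K = 0.
Proof.
have cK : #|[set lshift 1 i; rshift 3 (ord0 : 'I_1)]%SET| == 2.
  by rewrite cards2; case: i => [[|[|[|]]]].
exists (exist (fun I : {set 'I_4} => #|I| == 2) _ cK) => j; split.
  rewrite /horizontal dx2E; last by case: j => [[|[|[|]]]].
  rewrite !ffunE /= (_ : (_ < lshift 1 j)%N = false); last by case: j => [[|[|[|]]]].
  rewrite expr0 [_ *: _]mul1r; congr (_%:R : R); congr nat_of_bool.
  apply/eqP/eqP => [E|->//].
  have := set21 (lshift 1 i) (rshift 3 (ord0 : 'I_1)); rewrite E !inE eq_lrshift orbF.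
  by move/eqP/lshift_inj.
rewrite /vertical dx2E; last by case: j => [[|[|[|]]]].
rewrite !ffunE /= (_ : (_ == _) = false) ?scaler0//; apply/eqP => E.
by have := set22 (lshift 1 i) (rshift 3 (ord0 : 'I_1)); rewrite E !inE !eq_rlshift.
Qed.

Lemma torus_integral_is_linear n c (a b : cohom R n n) :
  (torus_integral (c *: a + b) : R^o) = c *: (torus_integral a : R^o) + torus_integral b.
Proof. by rewrite torus_integralD torus_integralZ. Qed.

Lemma intersection_form_linearl c (a a' b : cohom R 4 2) :
  (intersection_form (c *: a + a') b : R^o) =
  c *: (intersection_form a b : R^o) + intersection_form a' b.
Proof. by rewrite /intersection_form cup_is_linearl torus_integral_is_linear. Qed.

Lemma intersection_form_linearr c (a b b' : cohom R 4 2) :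
  (intersection_form a (c *: b + b') : R^o) =
  c *: (intersection_form a b : R^o) + intersection_form a b'.
Proof. by rewrite /intersection_form cup_is_linearr torus_integral_is_linear. Qed.

Lemma intersection_form_suml m (c : 'I_m -> R) (x : 'I_m -> cohom R 4 2) y :
  intersection_form (\sum_i c i *: x i) y = \sum_i c i * intersection_form (x i) y.
Proof.
exact: (linear_comb (W := R^o) (f := fun x => intersection_form x y)
  (fun c a b => intersection_form_linearl c a b y)).
Qed.

Lemma intersection_form_sumr m (c : 'I_m -> R) (x : 'I_m -> cohom R 4 2) y :
  intersection_form y (\sum_i c i *: x i) = \sum_i c i * intersection_form y (x i).
Proof.
exact: (linear_comb (W := R^o) (f := fun x => intersection_form y x)
  (fun c a b => intersection_form_linearr c y a b)).
Qed.

Lemma intersection_formDl (a b c : cohom R 4 2) :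
  intersection_form (a + b) c = intersection_form a c + intersection_form b c.
Proof. by have := intersection_form_linearl 1 a b c; rewrite !scale1r. Qed.

Lemma intersection_formDr (a b c : cohom R 4 2) :
  intersection_form c (a + b) = intersection_form c a + intersection_form c b.
Proof. by have := intersection_form_linearr 1 c a b; rewrite !scale1r. Qed.

Lemma sum_delta m (x : 'I_m -> R) j : \sum_i x i * (j == i)%:R = x j.
Proof.
rewrite (bigD1 j)//= eqxx mulr1 big1 ?addr0// => i ij.
by rewrite eq_sym (negbTE ij) mulr0.
Qed.

Lemma intersection_formE (x y x' y' : 'I_3 -> R) :
  intersection_form (\sum_i x i *: horizontal i + \sum_i y i *: vertical i)
                    (\sum_i x' i *: horizontal i + \sum_i y' i *: vertical i) =
  \sum_i (x i * y' i + y i * x' i).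
Proof.
rewrite intersection_formDl !intersection_formDr !intersection_form_suml big_split /=.
have H i : intersection_form (horizontal i) (\sum_i x' i *: horizontal i) = 0.
  rewrite intersection_form_sumr big1// => j _.
  by have [-> _ _ _] := intersection_basis i j; rewrite mulr0.
have V i : intersection_form (vertical i) (\sum_i y' i *: vertical i) = 0.
  rewrite intersection_form_sumr big1// => j _.
  by have [_ -> _ _] := intersection_basis i j; rewrite mulr0.
rewrite [X in X + _ + _]big1 => [|i _]; last by rewrite H mulr0.
rewrite add0r [X in _ + (_ + X)]big1 => [|i _]; last by rewrite V mulr0.
rewrite addr0.
congr (_ + _); apply: eq_bigr => i _; congr (_ * _); rewrite intersection_form_sumr.
  rewrite -[RHS]sum_delta; apply: eq_bigr => j _.
  by have [_ _ -> _] := intersection_basis i j.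
rewrite -[RHS]sum_delta; apply: eq_bigr => j _.
by have [_ _ _ ->] := intersection_basis i j.
Qed.

Lemma integral_H1_H2 (x y : 'I_3 -> R) :
  torus_integral (cup (\sum_i x i *: dx R i) (\sum_i y i *: star_dx i)) = \sum_i x i * y i.
Proof.
rewrite (linear_comb (fun c x y => cup_is_linearl _ c x y)).
rewrite (linear_comb (W := R^o) (@torus_integral_is_linear 3)); apply: eq_bigr => i _.
rewrite (linear_comb (fun c x y => cup_is_linearr _ c x y)).
rewrite (linear_comb (W := R^o) (@torus_integral_is_linear 3)) -[LHS]/(_ * _).
congr (_ * _); rewrite -[RHS]sum_delta; apply: eq_bigr => j _.
by rewrite integral_dx_star.
Qed.

Lemma symplectic_formE (x y x' y' : 'I_3 -> R) :
  symplectic_form (\sum_i x i *: (dx R i, 0) + \sum_i y i *: (0, star_dx i))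
                  (\sum_i x' i *: (dx R i, 0) + \sum_i y' i *: (0, star_dx i)) =
  2^-1 * \sum_i (x i * y' i - x' i * y i).
Proof.
have E (a b : 'I_3 -> R) : \sum_i a i *: (dx R i, 0) + \sum_i b i *: (0, star_dx i) =
    (\sum_i a i *: dx R i, \sum_i b i *: star_dx i) :> cohom R 3 1 * cohom R 3 2.
  rewrite [LHS]surjective_pairing /=; congr pair.
  - rewrite !(big_morph fst (fun _ _ => erefl) erefl) /= [X in _ + X]big1 ?addr0//.
    by move=> i _; rewrite scaler0.
  - rewrite !(big_morph snd (fun _ _ => erefl) erefl) /= [X in X + _]big1 ?add0r//.
    by move=> i _; rewrite scaler0.
by rewrite !E /symplectic_form /= !integral_H1_H2 sumrB.
Qed.

(** Pairing with the dual basis class extracts a coordinate. Smoothness of [uv_map] is tested on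
    linear functionals, so these transfer it to the components of u and v. *)
Lemma coordinate_functionals (i : 'I_3) :
  exists lu lv : 'Hom((cohom R 3 1 * cohom R 3 2)%type, R^o),
  forall x y, lu (H1_class x, H2_class y) = x 0 i /\ lv (H1_class x, H2_class y) = y 0 i.
Proof.
pose fu (z : cohom R 3 1 * cohom R 3 2) : R^o := torus_integral (cup z.1 (star_dx i)).
pose fv (z : cohom R 3 1 * cohom R 3 2) : R^o := torus_integral (cup (dx R i) z.2).
have lfu : linear fu.
  by move=> c a b; rewrite /fu /= cup_is_linearl torus_integral_is_linear.
have lfv : linear fv.
  by move=> c a b; rewrite /fv /= cup_is_linearr torus_integral_is_linear.
pose Lu : {linear _ -> R^o} := HB.pack fu (GRing.isLinear.Build R _ R^o *:%R _ lfu).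
pose Lv : {linear _ -> R^o} := HB.pack fv (GRing.isLinear.Build R _ R^o *:%R _ lfv).
exists (linfun Lu), (linfun Lv) => x y; rewrite !lfunE /= /fu /fv /= H2_classE; split.
  have -> : star_dx i = \sum_j (i == j)%:R *: star_dx j.
    rewrite (bigD1 i)//= eqxx scale1r big1 ?addr0// => j ji.
    by rewrite eq_sym (negbTE ji) scale0r.
  by rewrite (integral_H1_H2 (x 0)) sum_delta.
have -> : dx R i = \sum_j (i == j)%:R *: dx R j.
  rewrite (bigD1 i)//= eqxx scale1r big1 ?addr0// => j ji.
  by rewrite eq_sym (negbTE ji) scale0r.
by rewrite (integral_H1_H2 _ (y 0)); under eq_bigr do rewrite mulrC; rewrite sum_delta.
Qed.

End CohomologyAlgebra.

(** * Expansions of [utilde] and [uv_map] over fixed classes *)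

Section UTilde.
Variables (R : realType) (B : manifold R 3) (u v : B -> 'rV[R]_3).

Lemma utildeE p : utilde u v p =
  \sum_i u p 0 i *: horizontal R i + \sum_i v p 0 i *: vertical R i.
Proof.
rewrite /utilde H1_classE H2_classE; congr (_ + _).
  rewrite (linear_comb (@proj1_is_linear R 3 1 1)).
  rewrite (linear_comb (fun c x y => cup_is_linearl _ c x y)); apply: eq_bigr => i _.
  by rewrite dxE proj1_monomial ?cards1// proj2_monomial ?cards1// !imset_set1 -!dxE.
rewrite (linear_comb (@proj1_is_linear R 3 1 2)); apply: eq_bigr => i _; congr (_ *: _).
have /andP[/andP[ii _] _] := ordS_neq i.
by rewrite /star_dx /vertical !dx2E// proj1Z proj1_monomial ?cards2 ?ii// imsetU1 imset_set1.
Qed.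

Lemma uv_mapE p : uv_map u v p =
  \sum_i u p 0 i *: (dx R i, 0) + \sum_i v p 0 i *: (0, star_dx R i).
Proof.
rewrite /uv_map H1_classE H2_classE.
rewrite [RHS]surjective_pairing /=; congr pair.
- rewrite !(big_morph fst (fun _ _ => erefl) erefl) /= [X in _ = _ + X]big1 ?addr0//.
  by move=> i _; rewrite scaler0.
- rewrite !(big_morph snd (fun _ _ => erefl) erefl) /= [X in _ = X + _]big1 ?add0r//.
  by move=> i _; rewrite scaler0.
Qed.

End UTilde.

(** * Jacobian matrices in dimension 3 and Piola's identity *)

Section SmoothMatrices.
Variable R : realType.
Implicit Types (A : set 'rV[R]_3) (x y : 'rV[R]_3).

Lemma det2E (M : 'M[R]_2) :
  \det M = M ord0 ord0 * M (lift ord0 ord0) (lift ord0 ord0) -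
           M ord0 (lift ord0 ord0) * M (lift ord0 ord0) ord0.
Proof.
rewrite (expand_det_row _ ord0) !big_ord_recl big_ord0 /cofactor !det_mx11 !mxE /= addr0.
rewrite expr0 expr1 mul1r mulN1r mulrN; congr (_ * M _ _ - _ * M _ _); exact: val_inj.
Qed.

(** Taking the indices cyclically absorbs the cofactor signs. For a Jacobian matrix, row [k] becomes
    the cross product of the gradients of the components [ordS k] and [ordS (ordS k)]. *)
Lemma adj3E (M : 'M[R]_3) (k a : 'I_3) : (\adj M) k a =
  M (ordS a) (ordS k) * M (ordS (ordS a)) (ordS (ordS k)) -
  M (ordS a) (ordS (ordS k)) * M (ordS (ordS a)) (ordS k).
Proof.
rewrite mxE /cofactor det2E !mxE -signr_odd.
have E (i i' j j' : 'I_3) : val i = val i' -> val j = val j' -> M i j = M i' j'.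
  by move=> /val_inj -> /val_inj ->.
case: k => [[|[|[|]]]]//= Hk; case: a => [[|[|[|]]]]//= Ha; rewrite ?expr0 ?expr1 ?mul1r ?mulN1r ?opprB.
all: try by congr (_ * _ - _ * _); apply: E.
all: try by rewrite [X in _ - X]mulrC; congr (_ * _ - _ * _); apply: E.
all: try by rewrite [X in X - _]mulrC; congr (_ * _ - _ * _); apply: E.
all: try by rewrite mulrC [X in _ - X]mulrC; congr (_ * _ - _ * _); apply: E.
Qed.

(** The algebra behind the vanishing divergence of a cross product of two gradients: [p] and [q]
    stand for the gradients, [dp] and [dq] for the Hessians. *)
Lemma curl_sum (p q : 'I_3 -> R) (dp dq : 'I_3 -> 'I_3 -> R) :
  (forall a b, dp a b = dp b a) -> (forall a b, dq a b = dq b a) ->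
  \sum_a (dp a (ordS a) * q (ordS (ordS a)) + p (ordS a) * dq a (ordS (ordS a)) -
    (dq a (ordS a) * p (ordS (ordS a)) + q (ordS a) * dp a (ordS (ordS a)))) = 0.
Proof.
move=> Sp Sq; rewrite !big_ord_recl big_ord0.
set o0 : 'I_3 := ord0; set o1 : 'I_3 := lift _ _; set o2 : 'I_3 := lift _ _.
have E0 : ordS o0 = o1 by exact: val_inj.
have E1 : ordS o1 = o2 by exact: val_inj.
have E2 : ordS o2 = o0 by exact: val_inj.
rewrite !(E0, E1, E2) {E0 E1 E2}.
move: o0 o1 o2 => o0 o1 o2.
rewrite (Sp o1 o0) (Sp o2 o0) (Sp o2 o1) (Sq o1 o0) (Sq o2 o0) (Sq o2 o1); ring.
Qed.

(** Rows follow the direction of differentiation: the gradient of [u i] is column [i], and a change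
    of coordinates multiplies on the left. *)
Definition jacobian (u : 'I_3 -> 'rV[R]_3 -> R) y : 'M[R]_3 := \matrix_(a, i) partial a (u i) y.

Section Jacobian.
Variables (A : set 'rV[R]_3) (u : 'I_3 -> 'rV[R]_3 -> R).
Hypotheses (oA : open A) (su : forall i, smooth_on A (u i)).

Lemma smooth_adj_jacobian k a : smooth_on A (fun y => (\adj (jacobian u y)) k a).
Proof.
have sJ a' i : smooth_on A (fun y => jacobian u y a' i).
  by apply: (eq_smooth_on oA _ (smooth_on_partial a' (su i))) => y _; rewrite mxE.
pose J a' i y := jacobian u y a' i.
have := smooth_onD oA (smooth_onM oA (sJ (ordS a) (ordS k)) (sJ (ordS (ordS a)) (ordS (ordS k))))
  (smooth_onM oA (smooth_on_cst oA (-1))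
    (smooth_onM oA (sJ (ordS a) (ordS (ordS k))) (sJ (ordS (ordS a)) (ordS k)))).
by apply: eq_smooth_on => // y _; rewrite adj3E mulN1r.
Qed.

Lemma smooth_det_jacobian : smooth_on A (fun y => \det (jacobian u y)).
Proof.
have : smooth_on A (fun y => \sum_a partial a (u ord0) y * (\adj (jacobian u y)) ord0 a).
  apply: smooth_on_sum => // a _; apply: smooth_onM => //; last exact: smooth_adj_jacobian.
  exact: smooth_on_partial.
apply: eq_smooth_on => // y _; rewrite (expand_det_col _ ord0).
by apply: eq_bigr => a _; rewrite !mxE.
Qed.

(* Piola's identity, a consequence of the symmetry of second derivatives. *)
Lemma div_adj_jacobian k x : A x ->
  \sum_a partial a (fun y => (\adj (jacobian u y)) k a) x = 0.
Proof.
move=> Ax.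
have d2 a i : differentiable (partial a (u i)) x.
  exact/(smooth_on_differentiable _ Ax)/smooth_on_partial.
have C a b i : partial a (partial b (u i)) x = partial b (partial a (u i)) x.
  exact: partial_comm oA Ax (su i).
have E a : partial a (fun y => (\adj (jacobian u y)) k a) x =
   partial a (partial (ordS a) (u (ordS k))) x * partial (ordS (ordS a)) (u (ordS (ordS k))) x +
   partial (ordS a) (u (ordS k)) x * partial a (partial (ordS (ordS a)) (u (ordS (ordS k)))) x -
   (partial a (partial (ordS a) (u (ordS (ordS k)))) x * partial (ordS (ordS a)) (u (ordS k)) x +
   partial (ordS a) (u (ordS (ordS k))) x * partial a (partial (ordS (ordS a)) (u (ordS k))) x).
  have -> : (fun y => (\adj (jacobian u y)) k a) = fun y =>
     (partial (ordS a) (u (ordS k)) y * partial (ordS (ordS a)) (u (ordS (ordS k))) y) +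
     - (partial (ordS a) (u (ordS (ordS k))) y * partial (ordS (ordS a)) (u (ordS k)) y).
    by apply/funext => y; rewrite adj3E !mxE.
  rewrite partialD ?partialN ?partialM//; first exact: differentiableM.
    exact: differentiableM.
  by apply: differentiableN; exact: differentiableM.
rewrite (eq_bigr _ (fun a _ => E a)).
exact: (@curl_sum (fun a => partial a (u (ordS k)) x) (fun a => partial a (u (ordS (ordS k))) x)
  (fun a b => partial a (partial b (u (ordS k))) x)
  (fun a b => partial a (partial b (u (ordS (ordS k)))) x)).
Qed.

End Jacobian.
End SmoothMatrices.

(** * Determinants of positive definite matrices, and the density of the flux *)

Lemma posdef_det_gt0 (R : realType) n (M : 'M[R]_n) : posdef M -> 0 < \det M.
Proof.
move=> pM; rewrite ltNge; apply/negP => dM.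
(* A segment from the identity to [M]: its determinant is a polynomial equal to 1 at 0, so
   [\det M <= 0] would give a root t in [0, 1]. A null vector w there satisfies (1 - t) |w|^2 + t w
   M w^T = 0, which positivity excludes. *)
pose P : 'M[{poly R}]_n := (1 - 'X)%:M + 'X *: map_mx polyC M.
have PE t : (\det P).[t] = \det ((1 - t)%:M + t *: M).
  rewrite -horner_evalE -det_map_mx; congr (\det _); apply/matrixP => i j.
  rewrite !mxE /= /horner_eval.
  by rewrite hornerD hornerMn hornerM hornerX hornerC hornerD hornerN hornerX hornerC.
have [||t /andP[t0 t1]] := @poly_ivt R (- \det P) 0 1; rewrite ?ler01//.
  rewrite !hornerN !PE subr0 subrr scale0r addr0 det1 scale1r (_ : 0%:M = 0) ?add0r.
    by rewrite oppr_le0 ler01 oppr_ge0.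
  by apply/matrixP => i j; rewrite !mxE mul0rn.
rewrite rootE hornerN oppr_eq0 PE => /det0P[w w0 /(congr1 (fun z => (z *m w^T) 0 0))].
rewrite mulmxDr mulmxDl mul_mx_scalar -scalemxAl -scalemxAr -scalemxAl mul0mx !mxE => E.
have ww : 0 < \sum_j w 0 j * w^T j 0.
  have /rV0Pn[j wj] := w0.
  rewrite (bigD1 j)//= mxE ltr_wpDr ?sumr_ge0// => [k _|]; first by rewrite mxE -expr2 sqr_ge0.
  by rewrite -expr2 exprn_even_gt0.
have := pM w w0; rewrite mxE => wMw.
have := E; rewrite -/(mulmx _ _); set X := \sum_j _ in ww E *; set Y := \sum_j _ in wMw *.
move=> EE; have : (1 - t) * X + t * Y = 0 by [].
move: t0; rewrite le_eqVlt => /predU1P[<-|t0].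
  by rewrite subr0 mul1r mul0r addr0 => X0; rewrite X0 ltxx in ww.
apply/eqP; rewrite gt_eqF// ltr_wpDl ?mulr_gt0// mulr_ge0 ?subr_ge0//.
exact: ltW.
Qed.

Section Flux.
Variable R : realType.

Lemma differentiable_sqrt (V : normedModType R) (f : V -> R) x :
  differentiable f x -> 0 < f x -> differentiable (fun y => Num.sqrt (f y)) x.
Proof.
move=> df f0; apply: (@differentiable_comp _ _ _ _ f Num.sqrt) => //.
by apply/derivable1_diffP; have [] := is_derive1_sqrt f0.
Qed.

(** The square of s / (k Q) is a constant multiple of P / Q, so the two are stationary together. The
    derivatives come from differentiating the products [s y * s y] and (s / (k Q)) times k Q,
    instead of a root and a quotient. *)
Lemma partial_density n (P Q s : 'rV[R]_n -> R) k3 k a x :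
  differentiable P x -> differentiable Q x -> 0 < P x * Q x -> 0 < k3 -> 0 < k ->
  {near x, s =1 fun y => Num.sqrt (k3 * (P y * Q y))} ->
  differentiable s x /\
  (differentiable (fun y => s y * (k * Q y)^-1) x /\
  (partial a (fun y => s y * (k * Q y)^-1) x = 0 <->
   partial a P x * Q x = P x * partial a Q x)).
Proof.
move=> dP dQ PQ k30 k0 es.
have PQ3 : 0 < k3 * (P x * Q x) by rewrite mulr_gt0.
have es' : {near x, (fun y => Num.sqrt (k3 * (P y * Q y))) =1 s} by apply: filterS es.
have dPQ : differentiable (fun y => k3 * (P y * Q y)) x.
  by apply: differentiableM => //; exact: differentiableM.
have ds : differentiable s x.
  by apply: near_eq_differentiable es' _; exact: differentiable_sqrt.
have Q0 : Q x != 0 by apply: contraTneq PQ => ->; rewrite mulr0 ltxx.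
have s0 : 0 < s x by rewrite (nbhs_singleton es) sqrtr_gt0.
have ss : s x * s x = k3 * (P x * Q x).
  by rewrite (nbhs_singleton es) -expr2 sqr_sqrtr// ltW.
have dkQ : differentiable (fun y => k * Q y) x by exact: differentiableM.
have kQ0 : k * Q x != 0 by rewrite mulf_neq0// gt_eqF.
have dr : differentiable (fun y => s y * (k * Q y)^-1) x.
  by apply: differentiableM => //; exact: differentiableV.
split=> //; split=> //.
have nPQ : \forall y \near x, 0 < k3 * (P y * Q y).
  have /differentiable_continuous/cvgr_gt := dPQ; exact.
have E1 : partial a (fun y => s y * s y) x = partial a (fun y => k3 * (P y * Q y)) x.
  apply: near_eq_partial; apply: filterS2 nPQ es => y PQy ->.
  by rewrite -expr2 sqr_sqrtr// ltW.
rewrite (partialM _ ds ds) partialZ ?(partialM _ dP dQ) in E1; last exact: differentiableM.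
have nQ : \forall y \near x, k * Q y != 0.
  have /differentiable_continuous/cvgr_neq0 := dkQ; exact.
have E2 : partial a (fun y => (s y * (k * Q y)^-1) * (k * Q y)) x = partial a s x.
  by apply: near_eq_partial; apply: filterS nQ => y Qy; rewrite divfK.
rewrite (partialM _ dr dkQ) partialZ// in E2.
set r := partial a _ x; rewrite -/r in E2.
set p := partial a P x in E1 *; set q := partial a Q x in E1 E2 *.
(* After multiplying [E2] by [2 * s x * Q x], the density occurs only through [s x * s x] and its
   derivative, which are known from [ss] and [E1]. *)
have E3 : 2 * s x * k * (Q x * Q x) * r = k3 * Q x * (p * Q x - P x * q).
  have := E2 => /(congr1 (fun z => 2 * s x * Q x * z)).
  have -> : 2 * s x * Q x * (r * (k * Q x) + s x / (k * Q x) * (k * q)) =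
     2 * s x * k * (Q x * Q x) * r + 2 * (s x * s x) * q.
    field; rewrite Q0 gt_eqF//.
  move=> E; have -> : 2 * s x * k * (Q x * Q x) * r = 2 * s x * Q x * partial a s x - 2 * (s x * s x) * q.
    by rewrite -E addrK.
  have -> : 2 * s x * Q x * partial a s x = Q x * (partial a s x * s x + s x * partial a s x) by ring.
  by rewrite E1 ss; ring.
split=> [r0|E].
  move: E3; rewrite r0 mulr0 => /esym/eqP; rewrite mulf_eq0 mulf_eq0 (negbTE Q0) gt_eqF//= subr_eq0.
  by move/eqP.
have c0 : 2 * s x * k * (Q x * Q x) != 0.
  by rewrite !mulf_neq0// ?pnatr_eq0// gt_eqF.
by apply: (mulfI c0); rewrite E3 E subrr !mulr0.
Qed.

End Flux.

(** * The Laplacian of a metric of the form k U V^T *)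

Section Pencil.
Variables (R : realType) (A : set 'rV[R]_3) (u v : 'I_3 -> 'rV[R]_3 -> R) (k : R).
Variable G : 'rV[R]_3 -> 'M[R]_3.
Let U := jacobian u.
Let V := jacobian v.
Hypotheses (oA : open A) (k0 : 0 < k).
Hypotheses (su : forall i, smooth_on A (u i)) (sv : forall i, smooth_on A (v i)).
Hypothesis GE : forall y, A y -> G y = k *: (U y *m (V y)^T).
Hypothesis UVsym : forall y, A y -> U y *m (V y)^T = V y *m (U y)^T.
Hypothesis UVpos : forall y, A y -> 0 < \det (U y) * \det (V y).

(* The vanishing of d(det U / det V), with denominators cleared. *)
Definition conformal (x : 'rV[R]_3) := forall a,
  partial a (fun y => \det (U y)) x * \det (V x) = \det (U x) * partial a (fun y => \det (V y)) x.

Let s y := Num.sqrt (\det (G y)).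
Let rV y := s y * (k * \det (V y))^-1.
Let rU y := s y * (k * \det (U y))^-1.

Let det_neq0 y : A y -> (\det (U y) != 0) * (\det (V y) != 0).
Proof.
by move=> /UVpos UV; split; apply: contraTneq UV => ->; rewrite ?mul0r ?mulr0 ltxx.
Qed.

Let detG y : A y -> \det (G y) = k ^+ 3 * (\det (U y) * \det (V y)).
Proof. by move=> Ay; rewrite GE// detZ det_mulmx det_tr. Qed.

(** The gradient of a combination of the u_i and v_i with constant coefficients, as for any linear
    functional of [utilde]. *)
Let gradient f y (al be : 'I_3 -> R) :=
  forall a, partial a f y = \sum_i (U y a i * al i + V y a i * be i).

Let invG_gradient f y al be a : A y -> gradient f y al be ->
  \sum_j invmx (G y) a j * partial j f y =
  (k * \det (V y))^-1 * (\sum_i (\adj (V y)) i a * al i) +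
  (k * \det (U y))^-1 * (\sum_i (\adj (U y)) i a * be i).
Proof.
move=> Ay gf; have [U0 V0] := det_neq0 Ay.
pose ca : 'cV[R]_3 := \col_i al i; pose cb : 'cV[R]_3 := \col_i be i.
(* It suffices that [G y *m z] is the gradient. The first summand of [z] is cancelled against G = k
   U V^T, the second against the transposed form G = k V U^T, which is where the Lagrangian symmetry
   enters. *)
pose z : 'cV[R]_3 := (k * \det (V y))^-1 *: ((\adj (V y))^T *m ca) +
  (k * \det (U y))^-1 *: ((\adj (U y))^T *m cb).
have cancel (M N : 'M[R]_3) (w : 'cV[R]_3) : \det N != 0 ->
    (k *: (M *m N^T)) *m ((k * \det N)^-1 *: ((\adj N)^T *m w)) = M *m w.
  move=> N0; rewrite -scalemxAl -scalemxAr scalerA -!mulmxA (mulmxA N^T) -trmx_mul mul_adj_mx.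
  rewrite tr_scalar_mx mul_scalar_mx -scalemxAr scalerA.
  by rewrite (_ : _ * _ * _ = 1) ?scale1r//; field; rewrite N0 gt_eqF.
have Gz : \col_j partial j f y = G y *m z.
  rewrite /z mulmxDr {1}GE// cancel// GE// UVsym// cancel//.
  apply/matrixP => i j; rewrite !mxE gf big_split /=.
  by congr (_ + _); apply: eq_bigr => l _; rewrite !mxE.
have Gu : G y \in unitmx.
  by rewrite unitmxE detG// unitfE gt_eqF// mulr_gt0 ?exprn_gt0 ?UVpos.
have := mulKmx Gu z; rewrite -Gz => /matrixP/(_ a 0); rewrite !mxE => E.
transitivity (\sum_j invmx (G y) a j * (\col_j partial j f y) j 0).
  by apply: eq_bigr => j _; rewrite mxE.
by rewrite E; congr (_ * _ + _ * _); apply: eq_bigr => i _; rewrite !mxE.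
Qed.

Variable x : 'rV[R]_3.
Hypothesis Ax : A x.

Let sdU := smooth_det_jacobian oA su.
Let sdV := smooth_det_jacobian oA sv.
Let dU : differentiable (fun y => \det (U y)) x := smooth_on_differentiable sdU Ax.
Let dV : differentiable (fun y => \det (V y)) x := smooth_on_differentiable sdV Ax.

Let s_near : {near x, s =1 fun y => Num.sqrt (k ^+ 3 * (\det (U y) * \det (V y)))}.
Proof.
by apply: (@open_near_eq _ _ A) => // y; rewrite inE => Ay; rewrite /s detG.
Qed.

Let rV_conformal : differentiable rV x /\ (forall a, partial a rV x = 0 <->
  partial a (fun y => \det (U y)) x * \det (V x) = \det (U x) * partial a (fun y => \det (V y)) x).
Proof.
have k3 : 0 < k ^+ 3 by rewrite exprn_gt0.
have H a := partial_density a dU dV (UVpos Ax) k3 k0 s_near.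
by split=> [|a]; [have [_ []] := H ord0|have [_ []] := H a].
Qed.

Let rU_conformal : differentiable rU x /\ (forall a, partial a rU x = 0 <->
  partial a (fun y => \det (U y)) x * \det (V x) = \det (U x) * partial a (fun y => \det (V y)) x).
Proof.
have k3 : 0 < k ^+ 3 by rewrite exprn_gt0.
have VU : 0 < \det (V x) * \det (U x) by rewrite mulrC UVpos.
have s_near' : {near x, s =1 fun y => Num.sqrt (k ^+ 3 * (\det (V y) * \det (U y)))}.
  by apply: filterS s_near => y ->; rewrite [_ (U y) * _]mulrC.
have H a := partial_density a dV dU VU k3 k0 s_near'.
split=> [|a]; first by have [_ []] := H ord0.
have [_ [_ Ha]] := H a; split=> [/Ha E|E].
  by rewrite [LHS]mulrC [RHS]mulrC; exact: esym.
by apply/Ha; rewrite [LHS]mulrC [RHS]mulrC; exact: esym.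
Qed.

Lemma laplacian_pencil f al be : (forall y, A y -> gradient f y al be) ->
  laplacian G f x = (s x)^-1 *
    (\sum_i (\sum_a partial a rV x * (\adj (V x)) i a) * al i +
     \sum_i (\sum_a partial a rU x * (\adj (U x)) i a) * be i).
Proof.
move=> gf; rewrite /laplacian; congr (_ * _).
have daV i a : differentiable (fun y => (\adj (V y)) i a) x.
  exact/(smooth_on_differentiable _ Ax)/smooth_adj_jacobian.
have daU i a : differentiable (fun y => (\adj (U y)) i a) x.
  exact/(smooth_on_differentiable _ Ax)/smooth_adj_jacobian.
have [drV _] := rV_conformal; have [drU _] := rU_conformal.
have dV' i a : differentiable (fun y => rV y * (\adj (V y)) i a) x by exact: differentiableM.
have dU' i a : differentiable (fun y => rU y * (\adj (U y)) i a) x by exact: differentiableM.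
have dV'' i a : differentiable (fun y => al i * (rV y * (\adj (V y)) i a)) x by exact: differentiableM.
have dU'' i a : differentiable (fun y => be i * (rU y * (\adj (U y)) i a)) x by exact: differentiableM.
have E a : partial a (fun y => Num.sqrt (\det (G y)) * \sum_j invmx (G y) a j * partial j f y) x =
   \sum_i al i * (partial a rV x * (\adj (V x)) i a + rV x * partial a (fun y => (\adj (V y)) i a) x) +
   \sum_i be i * (partial a rU x * (\adj (U x)) i a + rU x * partial a (fun y => (\adj (U y)) i a) x).
  transitivity (partial a (fun y => \sum_i al i * (rV y * (\adj (V y)) i a) +
     \sum_i be i * (rU y * (\adj (U y)) i a)) x).
    apply: near_eq_partial; apply: (@open_near_eq _ _ A) => // y; rewrite inE => Ay.
    rewrite (invG_gradient _ Ay (gf y Ay)) mulrDr !mulrA; congr (_ + _);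
      by rewrite mulr_sumr; apply: eq_bigr => i _; rewrite mulrA mulrC.
  rewrite partialD; [|exact: differentiable_sumf|exact: differentiable_sumf].
  rewrite (partial_sum _ _ (fun i _ => dV'' i a)) (partial_sum _ _ (fun i _ => dU'' i a)).
  congr (_ + _); apply: eq_bigr => i _.
    by rewrite (partialZ _ _ (dV' i a)) (partialM _ drV (daV i a)).
  by rewrite (partialZ _ _ (dU' i a)) (partialM _ drU (daU i a)).
under eq_bigr do rewrite E.
(* Once the sums over [a] and [i] are exchanged, Piola's identity removes the terms in which the
   adjugate is differentiated. *)
have P (w : 'I_3 -> 'rV[R]_3 -> R) (r : 'rV[R]_3 -> R) (c : 'I_3 -> R) :
    (forall i, smooth_on A (w i)) ->
    \sum_a \sum_i c i * (partial a r x * (\adj (jacobian w x)) i a +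
       r x * partial a (fun y => (\adj (jacobian w y)) i a) x) =
    \sum_i (\sum_a partial a r x * (\adj (jacobian w x)) i a) * c i.
  move=> sw; rewrite exchange_big; apply: eq_bigr => i _ /=.
  rewrite -mulr_sumr mulrC big_split /= -[X in _ + X]mulr_sumr.
  by rewrite (div_adj_jacobian oA sw) ?mulr0 ?addr0.
rewrite big_split; congr (_ + _); [exact: (P v rV al sv)|exact: (P u rU be su)].
Qed.

Lemma conformal_laplacian f al be : conformal x -> (forall y, A y -> gradient f y al be) ->
  laplacian G f x = 0.
Proof.
move=> cx gf; rewrite (laplacian_pencil gf).
have [_ HV] := rV_conformal; have [_ HU] := rU_conformal.
rewrite !big1 ?addr0 ?mulr0// => i _; rewrite big1 ?mul0r// => a _.
  by rewrite (HU a).2 ?mul0r//; exact: cx.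
by rewrite (HV a).2 ?mul0r//; exact: cx.
Qed.

Lemma laplacian_conformal : (forall i, laplacian G (u i) x = 0) -> conformal x.
Proof.
move=> Lu a; have [_ HV] := rV_conformal; apply/HV.
have [U0 V0] := det_neq0 Ax.
have sx : s x != 0.
  by rewrite gt_eqF// sqrtr_gt0 detG// mulr_gt0 ?exprn_gt0// UVpos.
pose r : 'cV[R]_3 := \col_a partial a rV x.
have ar : \adj (V x) *m r = 0.
  apply/matrixP => i j; rewrite mxE [RHS]mxE.
  have gi y : A y -> gradient (u i) y (fun j => (i == j)%:R) (fun=> 0).
    move=> Ay b; under eq_bigr do rewrite mulr0 addr0.
    by rewrite sum_delta mxE.
  have := Lu i; rewrite (laplacian_pencil gi) [X in _ + X]big1 ?addr0; last first.
    by move=> l _; rewrite mulr0.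
  rewrite sum_delta => /eqP; rewrite mulf_eq0 invr_eq0 (negbTE sx) /= => /eqP.
  by move=> E; rewrite -[RHS]E; apply: eq_bigr => l _; rewrite [r l j]mxE mulrC.
(* Multiplying by [V x] turns its adjugate into the nonzero scalar [\det (V x)], so every derivative
   of [rV] vanishes. *)
have := congr1 (mulmx (V x)) ar; rewrite mulmxA mul_mx_adj mul_scalar_mx mulmx0.
by move=> /matrixP/(_ a 0)/eqP; rewrite !mxE mulf_eq0 (negbTE V0) /= => /eqP.
Qed.

End Pencil.

(** * Charts and differentials of vector-valued maps *)

Section Charts.
Variables (R : realType) (n : nat) (M : manifold R n).
Implicit Types (c d : chart R n M) (p : M).

Lemma chart_image c y : (c @` dom c) y -> dom c (chart_inv c y) /\ c (chart_inv c y) = y.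
Proof. by case=> p Dp <-; rewrite (chart_mapK Dp). Qed.

Lemma open_chart_image c (U : set M) : open U -> open (c @` (dom c `&` U)).
Proof.
move=> oU; rewrite openE => _ [p [Dp Up] <-].
have cp : (c @` dom c) (c p) by exists p.
have n1 : \forall y \near c p, (c @` dom c) y.
  by apply: open_nbhs_nbhs; split=> //; exact: chart_img_open.
have n2 : \forall y \near c p, U (chart_inv c y).
  apply: (chart_inv_continuous cp); rewrite (chart_mapK Dp).
  exact: open_nbhs_nbhs.
apply: filterS2 n1 n2 => y /chart_image[Dy cy] Uy.
by exists (chart_inv c y).
Qed.

Lemma chart_imageI c (U : set M) y : (c @` (dom c `&` U)) y ->
  [/\ (c @` dom c) y, dom c (chart_inv c y), U (chart_inv c y) & c (chart_inv c y) = y].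
Proof. by case=> p [Dp Up] <-; rewrite (chart_mapK Dp); split=> //; exists p. Qed.

Lemma smooth_setT_chart (f : M -> R) c : smooth_chart c -> smooth setT f ->
  smooth_on (c @` dom c) (f \o chart_inv c).
Proof. by move=> sc sf; have := sf c sc; rewrite setIT. Qed.

(** [map_partial] is written in the abstract basis [vbasis fullv]; this replaces it by any expansion
    over constant vectors, such as the horizontal and vertical classes. *)
Lemma map_partial_comb (V : vectType R) (I : finType) (h : I -> M -> R) (e : I -> V)
    (F : M -> V) c a x :
  (forall p, F p = \sum_i h i p *: e i) ->
  (forall i, differentiable (h i \o chart_inv c) x) ->
  map_partial F c a x = \sum_i partial a (h i \o chart_inv c) x *: e i.
Proof.
move=> FE dh; rewrite /map_partial.
have cE j : partial a (fun y => coord (vbasis fullv) j (F (chart_inv c y))) x =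
    \sum_i partial a (h i \o chart_inv c) x * coord (vbasis fullv) j (e i).
  transitivity (partial a (fun y => \sum_i coord (vbasis fullv) j (e i) * (h i \o chart_inv c) y) x).
    congr (partial _ _ _); apply/funext => y; rewrite FE linear_sum.
    by apply: eq_bigr => i _; rewrite linearZ mulrC.
  rewrite partial_sum => [|i _]; last by apply: differentiableM.
  by apply: eq_bigr => i _; rewrite partialZ// mulrC.
under eq_bigr do rewrite cE scaler_suml.
rewrite exchange_big; apply: eq_bigr => i _ /=.
rewrite [e i in RHS](coord_vbasis (memvf _)) scaler_sumr.
by apply: eq_bigr => j _; rewrite scalerA.
Qed.

End Charts.

(** * Minimality and the condition [conformal] on B *)

Section SemiFlat.
Variables (R : realType) (B : manifold R 3) (u v : B -> 'rV[R]_3).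
Hypothesis u_diffeo : local_diffeo u.
Hypothesis lag : lagrangian_immersion (@symplectic_form R) (uv_map u v).
Hypothesis pos : positive_definite (induced_metric u v).

Definition in_chart (w : B -> 'rV[R]_3) (c : chart R 3 B) (i : 'I_3) (y : 'rV[R]_3) : R :=
  w (chart_inv c y) 0 i.

Let U c := jacobian (in_chart u c).
Let V c := jacobian (in_chart v c).

Lemma smooth_uv i : smooth setT (fun p => u p 0 i) /\ smooth setT (fun p => v p 0 i).
Proof.
have [[sm _] _ _] := lag; have [lu [lv luv]] := coordinate_functionals R i.
split.
  have := sm lu; congr (smooth _ _); apply/funext => p /=; exact: (luv _ _).1.
have := sm lv; congr (smooth _ _); apply/funext => p /=; exact: (luv _ _).2.
Qed.

Lemma smooth_in_chart c i : smooth_chart c ->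
  smooth_on (c @` dom c) (in_chart u c i) /\ smooth_on (c @` dom c) (in_chart v c i).
Proof.
by move=> sc; have [su sv] := smooth_uv i; split;
  [exact: (smooth_setT_chart sc su)|exact: (smooth_setT_chart sc sv)].
Qed.

Let differentiable_in_chart c i y : smooth_chart c -> (c @` dom c) y ->
  differentiable (in_chart u c i) y /\ differentiable (in_chart v c i) y.
Proof.
move=> sc cy; have [su sv] := smooth_in_chart i sc.
by split; exact: smooth_on_differentiable cy.
Qed.

Lemma map_partial_utilde c a y : smooth_chart c -> (c @` dom c) y ->
  map_partial (utilde u v) c a y =
  \sum_i U c y a i *: horizontal R i + \sum_i V c y a i *: vertical R i.
Proof.
move=> sc cy.
pose h (k : 'I_3 + 'I_3) (p : B) := match k with inl i => u p 0 i | inr i => v p 0 i end.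
pose e (k : 'I_3 + 'I_3) := match k with inl i => horizontal R i | inr i => vertical R i end.
rewrite (@map_partial_comb _ _ _ _ _ h e).
- rewrite big_sumType /=; congr (_ + _); apply: eq_bigr => i _; by rewrite mxE.
- by move=> p; rewrite utildeE big_sumType.
- by move=> [] i; have [] := differentiable_in_chart i sc cy.
Qed.

Lemma map_partial_uv c a y : smooth_chart c -> (c @` dom c) y ->
  map_partial (uv_map u v) c a y =
  \sum_i U c y a i *: (dx R i, 0) + \sum_i V c y a i *: (0, star_dx R i).
Proof.
move=> sc cy.
pose h (k : 'I_3 + 'I_3) (p : B) := match k with inl i => u p 0 i | inr i => v p 0 i end.
pose e (k : 'I_3 + 'I_3) : (cohom R 3 1 * cohom R 3 2)%type :=
  match k with inl i => (dx R i, 0) | inr i => (0, star_dx R i) end.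
rewrite (@map_partial_comb _ _ _ _ _ h e).
- rewrite big_sumType /=; congr (_ + _); apply: eq_bigr => i _; by rewrite mxE.
- by move=> p; rewrite uv_mapE big_sumType.
- by move=> [] i; have [] := differentiable_in_chart i sc cy.
Qed.

Lemma lagrangian_symmetric c y : smooth_chart c -> (c @` dom c) y ->
  U c y *m (V c y)^T = V c y *m (U c y)^T.
Proof.
move=> sc cy; have [Dy Ey] := chart_image cy.
have [_ _ /(_ c _ sc Dy)] := lag; rewrite Ey => /matrixP E.
apply/matrixP => a b; have := E a b.
rewrite !mxE !map_partial_uv// symplectic_formE => /eqP.
rewrite mulf_eq0 invr_eq0 pnatr_eq0 /= sumrB subr_eq0 => /eqP.
move=> H; transitivity (\sum_i U c y a i * V c y b i).
  by apply: eq_bigr => i _; rewrite !mxE.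
by rewrite H; apply: eq_bigr => i _; rewrite !mxE mulrC.
Qed.

Lemma induced_metricE c y : smooth_chart c -> (c @` dom c) y ->
  induced_metric u v c y = 2 *: (U c y *m (V c y)^T).
Proof.
move=> sc cy; apply/matrixP => a b.
rewrite mxE !map_partial_utilde// intersection_formE big_split [RHS]mxE mulr_natl mulr2n.
rewrite {2}(lagrangian_symmetric sc cy).
by congr (_ + _); rewrite [RHS]mxE; apply: eq_bigr => i _; rewrite [_^T _ _]mxE.
Qed.

Lemma det_UV_gt0 c y : smooth_chart c -> (c @` dom c) y -> 0 < \det (U c y) * \det (V c y).
Proof.
move=> sc cy; have [Dy Ey] := chart_image cy.
have := posdef_det_gt0 (pos sc Dy); rewrite Ey induced_metricE// detZ det_mulmx det_tr.
by rewrite pmulr_rgt0// exprn_gt0.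
Qed.

(** A direction killed by the differential has length 0 for the pulled-back form, which positive
    definiteness forbids. *)
Lemma immersion_utilde : immersion (utilde u v).
Proof.
split=> [l c sc|c p sc Dp w W a].
  pose g p : R := \sum_i l (horizontal R i) * u p 0 i + \sum_i l (vertical R i) * v p 0 i.
  have E : l \o utilde u v = g.
    apply/funext => p /=; rewrite utildeE linearD !linear_sum /g; congr (_ + _);
      by apply: eq_bigr => i _; rewrite linearZ mulrC.
  rewrite E setIT; have oc := @chart_img_open _ _ _ c.
  apply: (smooth_onD oc); apply: (smooth_on_sum oc) => i _; apply: (smooth_onM oc);
    by [exact: smooth_on_cst|have [] := smooth_in_chart i sc].
have cp : (c @` dom c) (c p) by exists p.
have [/eqP|w0] := eqVneq (\row_i w i) 0.
  by move=> /eqP/rowP/(_ a); rewrite !mxE.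
have := pos sc Dp w0; set X := (_ *m _) 0 0.
suff -> : X = 0 by rewrite ltxx.
rewrite /X mxE.
transitivity (intersection_form (\sum_a w a *: map_partial (utilde u v) c a (c p))
   (\sum_a w a *: map_partial (utilde u v) c a (c p))).
  rewrite intersection_form_sumr; apply: eq_bigr => b _; rewrite !mxE mulrC; congr (_ * _).
  by rewrite intersection_form_suml; apply: eq_bigr => i _; rewrite !mxE.
(* That the form vanishes at the zero class is linearity for a sum over the empty ['I_0]. *)
by rewrite W; have := @intersection_form_suml R 0 (fun=> 0) (fun=> 0) 0; rewrite !big_ord0.
Qed.

Definition conformal_everywhere := forall c p, smooth_chart c -> dom c p ->
  conformal (in_chart u c) (in_chart v c) (c p).

Lemma gradient_comb f al be c y a : smooth_chart c -> (c @` dom c) y ->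
  (forall p, f p = \sum_i al i * u p 0 i + \sum_i be i * v p 0 i) ->
  partial a (f \o chart_inv c) y = \sum_i (U c y a i * al i + V c y a i * be i).
Proof.
move=> sc cy fE.
have du i : differentiable (fun y => al i * in_chart u c i y) y.
  by apply: differentiableM => //; have [] := differentiable_in_chart i sc cy.
have dv i : differentiable (fun y => be i * in_chart v c i y) y.
  by apply: differentiableM => //; have [] := differentiable_in_chart i sc cy.
transitivity (partial a (fun y => \sum_i al i * in_chart u c i y + \sum_i be i * in_chart v c i y) y).
  by congr (partial _ _ _); apply/funext => z /=; rewrite fE.
rewrite partialD; [|exact: differentiable_sumf|exact: differentiable_sumf].
rewrite !partial_sum// big_split /=; congr (_ + _); apply: eq_bigr => i _.
  by rewrite partialZ; [rewrite mxE mulrC|have [] := differentiable_in_chart i sc cy].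
by rewrite partialZ; [rewrite mxE mulrC|have [] := differentiable_in_chart i sc cy].
Qed.

Section LaplacianInChart.
Variables (c : chart R 3 B) (A : set 'rV[R]_3) (G : 'rV[R]_3 -> 'M[R]_3) (k : R).
Hypotheses (sc : smooth_chart c) (oA : open A) (Ac : A `<=` c @` dom c) (k0 : 0 < k).
Hypothesis GE : forall y, A y -> G y = k *: (U c y *m (V c y)^T).

Let suA i : smooth_on A (in_chart u c i).
Proof. exact: smooth_onS Ac (smooth_in_chart i sc).1. Qed.

Let svA i : smooth_on A (in_chart v c i).
Proof. exact: smooth_onS Ac (smooth_in_chart i sc).2. Qed.

Let symA y : A y -> U c y *m (V c y)^T = V c y *m (U c y)^T.
Proof. by move=> /Ac; exact: lagrangian_symmetric. Qed.

Let posA y : A y -> 0 < \det (U c y) * \det (V c y).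
Proof. by move=> /Ac; exact: det_UV_gt0. Qed.

(** Applied with k = 2 to the induced metric on a whole chart, and with k = 1 to the Hessian metric
    on the part of a chart where the potential is defined. *)
Lemma conformal_harmonic f al be x : A x ->
  (forall p, f p = \sum_i al i * u p 0 i + \sum_i be i * v p 0 i) ->
  conformal (in_chart u c) (in_chart v c) x -> laplacian G (f \o chart_inv c) x = 0.
Proof.
move=> Ax fE cx.
apply: (conformal_laplacian oA k0 suA svA GE symA posA Ax cx) => y /Ac cy a.
exact: gradient_comb.
Qed.

Lemma harmonic_conformal x : A x ->
  (forall i, laplacian G ((fun p => u p 0 i) \o chart_inv c) x = 0) ->
  conformal (in_chart u c) (in_chart v c) x.
Proof. by move=> Ax Lu; exact: (laplacian_conformal oA k0 suA svA GE symA posA Ax Lu). Qed.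

End LaplacianInChart.

Lemma utilde_horizontal_coord i (K : ksubset 4 2) p :
  (forall j, horizontal R j K = (j == i)%:R /\ vertical R j K = 0) ->
  utilde u v p K = u p 0 i.
Proof.
move=> HK; rewrite utildeE ffunE !sum_ffunE.
rewrite [X in _ + X]big1 ?addr0 => [|j _]; last by rewrite ffunE (HK j).2 scaler0.
rewrite -[RHS](sum_delta (u p 0)); apply: eq_bigr => j _.
by rewrite ffunE (HK j).1 eq_sym.
Qed.

Lemma minimal_conformal :
  minimal_immersion (@intersection_form R) (utilde u v) <-> conformal_everywhere.
Proof.
have GE c (sc : smooth_chart c) y : (c @` dom c) y ->
    induced_metric u v c y = 2 *: (U c y *m (V c y)^T) by exact: induced_metricE.
have k2 : 0 < (2 : R) by [].
split=> [[_ hm] c p sc Dp|ce].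
  have cp : (c @` dom c) (c p) by exists p.
  apply: (harmonic_conformal sc (@chart_img_open _ _ _ c) (fun _ h => h) k2 (GE c sc) cp) => i.
  have [K HK] := horizontal_coord R i.
  pose ev (z : cohom R 4 2) : R^o := z K.
  have lev : linear ev by move=> r a b; rewrite /ev !ffunE.
  pose L : {linear cohom R 4 2 -> R^o} := HB.pack ev (GRing.isLinear.Build R _ R^o *:%R _ lev).
  suff -> : (fun q => u q 0 i) = linfun L \o utilde u v by exact: hm sc Dp.
  apply/funext => q; rewrite -[RHS]/(linfun L (utilde u v q)) lfunE.
  by rewrite -[RHS]/(utilde u v q K) (utilde_horizontal_coord q HK).
split; first exact: immersion_utilde.
move=> l c p sc Dp.
have cp : (c @` dom c) (c p) by exists p.
apply: (conformal_harmonic sc (@chart_img_open _ _ _ c) (fun _ h => h) k2 (GE c sc)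
  (al := fun i => l (horizontal R i)) (be := fun i => l (vertical R i)) cp).
- move=> q /=; rewrite utildeE linearD !linear_sum; congr (_ + _);
    by apply: eq_bigr => i _; rewrite linearZ mulrC.
- exact: ce.
Qed.

Lemma in_chart_coordinates c y : coordinates u c -> (c @` dom c) y -> u (chart_inv c y) = y.
Proof. by move=> [_ cu] /chart_image[Dy Ey]; rewrite -cu. Qed.

Lemma jacobian_coordinates c y : coordinates u c -> (c @` dom c) y -> U c y = 1%:M.
Proof.
move=> cc cy; apply/matrixP => a i; rewrite !mxE -(partial_coord a i y).
apply: near_eq_partial; apply: (open_near_eq (@chart_img_open _ _ _ c)) cy => z.
by rewrite inE => cz; rewrite /in_chart in_chart_coordinates.
Qed.

Lemma conformal_coordinates c y : coordinates u c -> (c @` dom c) y ->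
  conformal (in_chart u c) (in_chart v c) y <->
  forall a, partial a (fun z => \det (V c z)) y = 0.
Proof.
move=> cc cy.
have U1 : \det (U c y) = 1 by rewrite jacobian_coordinates// det1.
have dU a : partial a (fun z => \det (U c z)) y = 0.
  rewrite -(partial_cst 1 a y); apply: near_eq_partial.
  apply: (open_near_eq (@chart_img_open _ _ _ c)) cy => z.
  by rewrite inE => cz; rewrite jacobian_coordinates// det1.
rewrite /conformal -/(U c) -/(V c) U1; split=> H a.
  by have := H a; rewrite dU mul0r mul1r.
by rewrite dU mul0r mul1r H.
Qed.

(** The coordinates of [c0] are the components of u, so the transition [g] from [c] to [c0] has
    Jacobian matrix [U c]. Hence det V in [c] is det U in [c] times det V in [c0] composed with [g],
    and this last factor is stationary at the point by hypothesis. *)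
Lemma conformal_change_chart c c0 p : smooth_chart c -> coordinates u c0 ->
  dom c p -> dom c0 p -> conformal (in_chart u c0) (in_chart v c0) (c0 p) ->
  conformal (in_chart u c) (in_chart v c) (c p).
Proof.
move=> sc cc0 Dp D0p; have [sc0 c0u] := cc0.
have c0p : (c0 @` dom c0) (c0 p) by exists p.
move=> /(conformal_coordinates cc0 c0p) H a.
have oA : open (c @` (dom c `&` dom c0)) by apply: open_chart_image; exact: chart_dom_open.
have Ap : (c @` (dom c `&` dom c0)) (c p) by exists p.
have cp : (c @` dom c) (c p) by exists p.
pose g y := u (chart_inv c y).
have c0g q : dom c0 q -> (c0 @` dom c0) (u q) by move=> Dq; rewrite -c0u//; exists q.
have gp : g (c p) = c0 p by rewrite /g (chart_mapK Dp) c0u.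
have VE y : (c @` (dom c `&` dom c0)) y -> V c y = U c y *m V c0 (g y).
  move=> Ay; have [cy Dy D0y Ey] := chart_imageI Ay.
  apply/matrixP => b i; rewrite mxE [RHS]mxE.
  transitivity (partial b (in_chart v c0 i \o g) y).
    apply: near_eq_partial; apply: (open_near_eq oA) Ay => z; rewrite inE => Az.
    have [_ _ D0z _] := chart_imageI Az.
    by rewrite /in_chart /g /= -c0u// (chart_mapK D0z).
  rewrite partial_comp => [||j].
  - by apply: eq_bigr => j _; rewrite !mxE mulrC.
  - by have [] := differentiable_in_chart i sc0 (c0g _ D0y).
  - by have [] := differentiable_in_chart j sc cy.
have sdet w (d : chart R 3 B) : smooth_chart d -> (forall i, smooth_on (d @` dom d) (w i)) ->
    smooth_on (d @` dom d) (fun y => \det (jacobian w y)).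
  by move=> sd sw; apply: smooth_det_jacobian => //; exact: chart_img_open.
have dUc : differentiable (fun y => \det (U c y)) (c p).
  by apply: smooth_on_differentiable cp; apply: sdet => // i; have [] := smooth_in_chart i sc.
have dV0 : differentiable (fun y => \det (V c0 y)) (g (c p)).
  rewrite gp; apply: smooth_on_differentiable c0p.
  by apply: sdet => // i; have [] := smooth_in_chart i sc0.
have dg i : differentiable (fun y => g y 0 i) (c p).
  by have [] := differentiable_in_chart i sc cp.
have dV0g : differentiable ((fun y => \det (V c0 y)) \o g) (c p).
  by apply: differentiable_comp => //; exact: differentiable_row.
have -> : partial a (fun y => \det (V c y)) (c p) =
    partial a (fun y => \det (U c y)) (c p) * \det (V c0 (g (c p))).
  transitivity (partial a (fun y => \det (U c y) * ((fun y => \det (V c0 y)) \o g) y) (c p)).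
    apply: near_eq_partial; apply: (open_near_eq oA) Ap => z; rewrite inE => Az.
    by rewrite VE// det_mulmx.
  rewrite partialM// partial_comp// big1 ?mulr0 ?addr0// => i _.
  by rewrite gp H mul0r.
by rewrite -/(V c) VE// det_mulmx mulrCA.
Qed.

(** * Local potentials, their Hessians and the Monge-Ampere equation *)

Section Potential.
Variables (O : set B) (phi : B -> R).
Hypothesis pot : potential u v O phi.

Lemma hessian_potential c y : coordinates u c -> (c @` (dom c `&` O)) y ->
  hessian_u phi c y = V c y.
Proof.
move=> cc Ay; have [oO _ vphi] := pot.
apply/matrixP => i j; rewrite !mxE; apply: near_eq_partial.
apply: (open_near_eq (open_chart_image oO)) Ay => z; rewrite inE => Az.
have [cz Dz Oz Ez] := chart_imageI Az.
by rewrite /in_chart (vphi _ _ _ cc Dz Oz) in_chart_coordinates.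
Qed.

Lemma hessian_pencil c y : coordinates u c -> (c @` (dom c `&` O)) y ->
  hessian_u phi c y = U c y *m (V c y)^T.
Proof.
move=> cc Ay; have [cy _ _ _] := chart_imageI Ay; have [sc _] := cc.
rewrite hessian_potential// (lagrangian_symmetric sc cy).
by rewrite jacobian_coordinates// trmx1 mulmx1.
Qed.

Lemma induced_metric_potential c p : coordinates u c -> dom c p -> O p ->
  induced_metric u v c (u p) = 2 *: hessian_u phi c (u p).
Proof.
move=> cc Dp Op; have [sc cu] := cc; rewrite -cu//.
by rewrite (induced_metricE sc) ?hessian_pencil//; exists p.
Qed.

Lemma monge_ampere_conformal c p : coordinates u c -> dom c p -> O p ->
  (forall w, 'd (fun x => \det (hessian_u phi c x)) (u p) w = 0) <->
  conformal (in_chart u c) (in_chart v c) (u p).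
Proof.
move=> cc Dp Op; have [sc cu] := cc; have [oO _ _] := pot.
have cp : (c @` dom c) (u p) by rewrite -cu//; exists p.
have Ap : (c @` (dom c `&` O)) (u p) by rewrite -cu//; exists p.
have sdV : smooth_on (c @` dom c) (fun y => \det (V c y)).
  apply: smooth_det_jacobian; first exact: chart_img_open.
  by move=> i; have [] := smooth_in_chart i sc.
have dV := smooth_on_differentiable sdV cp.
have E : {near u p, (fun y => \det (V c y)) =1 fun x => \det (hessian_u phi c x)}.
  apply: (open_near_eq (open_chart_image oO)) Ap => z; rewrite inE => Az.
  by rewrite hessian_potential.
have dH := near_eq_differentiable E dV.
have EH a : partial a (fun y => \det (V c y)) (u p) =
    partial a (fun x => \det (hessian_u phi c x)) (u p) by exact: near_eq_partial.
apply: (iff_trans _ (iff_sym (conformal_coordinates cc cp))); split=> [H a|H w].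
  by rewrite EH partialE.
by rewrite diff_partial// big1// => i _; rewrite -EH H mulr0.
Qed.

Lemma hessian_harmonic_conformal c p : coordinates u c -> dom c p -> O p ->
  (forall K, laplacian (hessian_u phi c) ((fun p => utilde u v p K) \o chart_inv c) (u p) = 0) <->
  conformal (in_chart u c) (in_chart v c) (u p).
Proof.
move=> cc Dp Op; have [sc cu] := cc; have [oO _ _] := pot.
have Ap : (c @` (dom c `&` O)) (u p) by rewrite -cu//; exists p.
have Ac : c @` (dom c `&` O) `<=` c @` dom c by move=> y /chart_imageI[].
have GE y : (c @` (dom c `&` O)) y -> hessian_u phi c y = 1 *: (U c y *m (V c y)^T).
  by move=> Ay; rewrite scale1r hessian_pencil.
split=> [H|H K].
  apply: (harmonic_conformal sc (open_chart_image oO) Ac ltr01 GE Ap) => i.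
  have [K HK] := horizontal_coord R i.
  suff -> : (fun q => u q 0 i) = (fun q => utilde u v q K) by exact: H.
  by apply/funext => q; rewrite (utilde_horizontal_coord q HK).
apply: (conformal_harmonic sc (open_chart_image oO) Ac ltr01 GE Ap
  (al := fun i => horizontal R i K) (be := fun i => vertical R i K)) => // q.
rewrite utildeE !ffunE !sum_ffunE; congr (_ + _);
  by apply: eq_bigr => i _; rewrite ffunE mulrC.
Qed.

End Potential.

Lemma exists_potential p : exists O phi, O p /\ potential u v O phi.
Proof.
have [c0 cc0 Dp] := u_diffeo p; have [sc0 c0u] := cc0.
have c0p : (c0 @` dom c0) (c0 p) by exists p.
have [|i j y cy|r r0 [psi Hpsi]] :=
  @local_potential _ _ (c0 @` dom c0) (in_chart v c0) _ (@chart_img_open _ _ _ c0) c0p.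
- by move=> i; have [] := smooth_in_chart i sc0.
(* In the coordinates u_i the matrix U is the identity, so the Lagrangian condition says that V is
   symmetric: the 1-form v^i du_i is closed. *)
- have := lagrangian_symmetric sc0 cy; rewrite jacobian_coordinates// mul1mx trmx1 mulmx1.
  by move=> /matrixP/(_ i j); rewrite !mxE.
(* The part of B lying over the ball where [psi] is controlled. There [c0] agrees with u, so
   [psi \o u] is a potential that does not refer to the chart. *)
pose O := [set q | dom c0 q /\ `|c0 q - c0 p| < r].
have oO : open O.
  rewrite openE => q [Dq qr].
  have n1 : \forall z \near q, dom c0 z by apply: open_nbhs_nbhs; split=> //; exact: chart_dom_open.
  have r' : 0 < r - `|c0 q - c0 p| by rewrite subr_gt0.
  have n2 : \forall z \near q, `|c0 q - c0 z| < r - `|c0 q - c0 p|.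
    by have /cvgrPdist_lt/(_ _ r') := chart_map_continuous Dq; exact.
  apply: filterS2 n1 n2 => z Dz; rewrite ltrBrDr distrC => zr; split=> //.
  by rewrite (le_lt_trans _ zr)// (le_trans _ (ler_normD _ _))// addrA subrK.
exists O, (psi \o u); split; first by split=> //; rewrite subrr normr0.
have psiP q : O q -> differentiable psi (u q) /\ forall i, partial i psi (u q) = v q 0 i.
  case=> Dq /Hpsi; rewrite c0u// => -[cq dq pq]; split=> // i.
  by rewrite pq /in_chart -c0u// (chart_mapK Dq).
split=> //.
- move=> c sc; have oA := open_chart_image (c := c) oO.
  have AP y : (c @` (dom c `&` O)) y -> differentiable ((psi \o u) \o chart_inv c) y /\
      forall a, partial a ((psi \o u) \o chart_inv c) y =
        \sum_i in_chart v c i y * partial a (in_chart u c i) y.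
    move=> Ay; have [cy Dy Oy Ey] := chart_imageI Ay.
    have [dpsi ppsi] := psiP _ Oy.
    have du i : differentiable (fun z => u (chart_inv c z) 0 i) y.
      by have [] := differentiable_in_chart i sc cy.
    split=> [|a].
      apply: (@differentiable_comp _ _ _ _ (u \o chart_inv c) psi) => //.
      exact: differentiable_row.
    rewrite (@partial_comp _ _ _ psi (u \o chart_inv c))//.
    by apply: eq_bigr => i _; rewrite ppsi.
  apply/smooth_onP; split=> [y /AP[]//|a].
  (* By the chain rule the derivatives of phi are combinations of the v^i with derivatives of the
     u_i, already smooth on the chart. *)
  have : smooth_on (c @` (dom c `&` O))
      (fun y => \sum_i in_chart v c i y * partial a (in_chart u c i) y).
    apply: smooth_onS (_ : c @` (dom c `&` O) `<=` c @` dom c) _.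
      by move=> y /chart_imageI[].
    have oc := @chart_img_open _ _ _ c.
    apply: (smooth_on_sum oc) => i _; have [su sv] := smooth_in_chart i sc.
    by apply: (smooth_onM oc) => //; exact: smooth_on_partial.
  by apply: (eq_smooth_on oA) => y; rewrite inE => /AP[_ ->].
- move=> c q i cc Dq Oq; have [sc cu] := cc.
  have [dpsi <-] := psiP _ Oq.
  apply: near_eq_partial.
  have cq : (c @` dom c) (u q) by rewrite -cu//; exists q.
  apply: (open_near_eq (@chart_img_open _ _ _ c)) cq => z; rewrite inE => cz.
  by rewrite /= in_chart_coordinates.
Qed.

End SemiFlat.

Theorem mainTheorem9 (R : realType) (B : manifold R 3) (u v : B -> 'rV[R]_3)
    (u_diffeo : local_diffeo u) (v_diffeo : local_diffeo v)
    (uv_lagrangian : lagrangian_immersion (@symplectic_form R) (uv_map u v))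
    (metric_pos : positive_definite (induced_metric u v)) :
  [/\ forall p : B, exists U phi, U p /\ potential u v U phi,
      exists2 k : R, 0 < k &
        forall U phi, potential u v U phi ->
        forall c p, coordinates u c -> dom c p -> U p ->
          induced_metric u v c (u p) = k *: hessian_u phi c (u p),
      minimal_immersion (@intersection_form R) (utilde u v) <->
        (forall U phi, potential u v U phi ->
         forall K, hessian_harmonic u U phi (fun p => utilde u v p K))
    & minimal_immersion (@intersection_form R) (utilde u v) <->
        (forall U phi, potential u v U phi -> monge_ampere u U phi)].
Proof.
have minE := minimal_conformal uv_lagrangian metric_pos.
have potE := exists_potential u_diffeo uv_lagrangian.
have harmE := @hessian_harmonic_conformal _ _ _ _ uv_lagrangian metric_pos.
have maE := @monge_ampere_conformal _ _ _ _ uv_lagrangian.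
(* One u-chart around the point, supplied by [u_diffeo], decides the condition in every smooth chart
   there. *)
have change p c : smooth_chart c -> dom c p ->
    (forall c0, coordinates u c0 -> dom c0 p ->
       conformal (in_chart u c0) (in_chart v c0) (u p)) ->
    conformal (in_chart u c) (in_chart v c) (c p).
  move=> sc Dp H; have [c0 cc0 D0p] := u_diffeo p.
  apply: (conformal_change_chart uv_lagrangian sc cc0 Dp D0p).
  by rewrite (cc0.2 p D0p); exact: H.
have at_u c p : conformal_everywhere u v -> coordinates u c -> dom c p ->
    conformal (in_chart u c) (in_chart v c) (u p).
  by move=> ce [sc cu] Dp; rewrite -cu//; exact: ce.
split=> //.
- exists 2 => // O phi pot c p cc Dp Op.
  exact: (induced_metric_potential uv_lagrangian pot cc Dp Op).
- apply: (iff_trans minE); split=> [ce O phi pot K c p cc Dp Op|H c p sc Dp].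
    by apply: (harmE _ _ pot c p cc Dp Op).2; exact: at_u.
  (* The assumption ranges over all potentials; a local one around [p], which always exists, carries
     the information needed at [p]. *)
  apply: change => // c0 cc0 D0p; have [W [phi [Wp pot]]] := potE p.
  by apply/(harmE _ _ pot c0 p cc0 D0p Wp) => K; exact: H pot K c0 p cc0 D0p Wp.
- apply: (iff_trans minE); split=> [ce O phi pot c p cc Dp Op|H c p sc Dp].
    by apply: (maE _ _ pot c p cc Dp Op).2; exact: at_u.
  apply: change => // c0 cc0 D0p; have [W [phi [Wp pot]]] := potE p.
  by apply/(maE _ _ pot c0 p cc0 D0p Wp); exact: H pot c0 p cc0 D0p Wp.
Qed.
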